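(* Let $\mathcal{M}=(E,\mathcal{L},g)$ be an affine oriented matroid on $E=\{1,\dots,n,g\}$, and let $O\subseteq\mathbf{k}[x_1,\dots,x_n,y_1,\dots,y_n]$ be its oriented matroid ideal. Then $O$ is minimally generated by the monomials $m_{xy}(Z)$ corresponding to the vertices $Z$ of the bounded complex $B_\mathcal{M}$. The bounded complex $B_\mathcal{M}$ (vertex $Z$ labeled $m_{xy}(Z)$) is an $O$-complex; thus its cellular complex $C_\bullet(B_\mathcal{M},O)$ gives a minimal $\mathbb{N}^{2n}$-graded free $\mathbf{k}[\mathbf{x},\mathbf{y}]$-resolution of $O$.
   Context: Sign vectors on a finite set $E$: $X\in\{+,-,0\}^E$; $(-X)_i=-X_i$; composition $(X\circ Y)_i=X_i$ if $X_i\neq0$, else $Y_i$; separation set $S(X,Y)=\{i:X_i=-Y_i\neq0\}$. A set $\mathcal{L}\subseteq\{+,-,0\}^E$ is the set of covectors of an oriented matroid on $E$ if: $0\in\mathcal{L}$; $X\in\mathcal{L}\Rightarrow -X\in\mathcal{L}$; $X,Y\in\mathcal{L}\Rightarrow X\circ Y\in\mathcal{L}$; and if $X,Y\in\mathcal{L}$, $i\in S(X,Y)$, then some $Z\in\mathcal{L}$ has $Z_i=0$ and $Z_j=(X\circ Y)_j=(Y\circ X)_j$ for all $j\notin S(X,Y)$. Sign vectors are partially ordered componentwise by $0<+$, $0<-$. An affine oriented matroid $\mathcal{M}=(E,\mathcal{L},g)$ is such an oriented matroid with a distinguished $g\in E$ with $X_g\neq0$ for some $X\in\mathcal{L}$;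 its positive part is $\mathcal{L}^+=\{X\in\mathcal{L}:X_g=+\}$. A covector $X$ is bounded if every nonzero covector $Y\le X$ lies in $\mathcal{L}^+$. By the Topological Representation Theorem, $\mathcal{L}^+\cup\{\hat0,\hat1\}$ is the face lattice of a regular CW-complex (an arrangement of pseudohyperplanes, homeomorphic to a ball); the bounded complex $B_\mathcal{M}$ is its subcomplex formed by the cells of the nonzero bounded covectors; its face poset is the poset of bounded covectors (the zero covector being the empty cell), and its vertices are the cocircuits (minimal nonzero covectors) lying in $\mathcal{L}^+$. For $Z\in\{+,-,0\}^E$ put $m_{xy}(Z)=\prod_{i:Z_i=+}x_i\prod_{i:Z_i=-}y_i$ with $x_g=y_g=1$. The oriented matroid ideal $O$ is generated by $\{m_{xy}(Z):Z\in\mathcal{L}^+\}$. Cellular complexes: for a monomial ideal $I$ in a polynomial ring $S$ over a field $\mathbf{k}$ and a regular CW-complex $\Delta$ whose vertices are labeled by monomials generating $I$, each nonempty cell $c$ gets the label $m_c=\mathrm{lcm}$ of its vertex labels, the empty cell gets $1$; $C_\bullet(\Delta,I)$ has $C_i=\bigoplus_{\dim c=i}\langle m_c\rangle$ ($i\ge-1$, $C_{-1}=S$) and differential $\sum[c:c']\,(\text{inclusion }\langle m_c\rangle\to\langle m_{c'}\rangle)$ over codimension-one faces, $[c:c']$ incidence numbers. $\Delta_{\le m}$ is the subcomplex of cells with $m_c\mid m$. $\Delta$ is an $I$-complex if every nonempty $\Delta_{\le m}$ is acyclic over $\mathbf{k}$ and $m_c\ne m_{c'}$ whenever $c'$ is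 a proper face of $c$; ''gives a minimal free resolution of $I$'' means $C_{\ge0}$ is exact, $\mathrm{im}(C_0\to C_{-1})=I$, and it is minimal.
   Formalization: In the definition of an O-complex, the condition that m_c and m_c' differ for a proper face c' of c is required only for nonempty c'; when some covector is nonzero only at g, then O is the whole ring and the single vertex has label 1, the same as the empty cell. *)

(* Defs.v *)
From HB Require Import structures.
From mathcomp Require Export all_boot all_order all_algebra.
From mathcomp.multinomials Require Export mpoly.

Set Implicit Arguments.
Unset Strict Implicit.
Unset Printing Implicit Defensive.

Import GRing.Theory.

Local Open Scope ring_scope.

(* Signs: None is 0, Some true is +, Some false is -. *)
Definition sign : Type := option bool.
Notation szero := (None : sign) (only parsing).
Notation splus := (Some true : sign) (only parsing).
Notation sminus := (Some false : sign) (only parsing).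
Definition sopp (s : sign) : sign := omap negb s.

Definition signvec (E : finType) : finType := {ffun E -> option bool}.

Section OrientedMatroids.

Variable E : finType.
Implicit Types (X Y Z : signvec E) (L : {set signvec E}) (g : E).

Definition sv0 : signvec E := [ffun=> szero].
Definition svopp X : signvec E := [ffun i => sopp (X i)].
Definition svcomp X Y : signvec E :=
  [ffun i => if X i == szero then Y i else X i].
Definition sep X Y : {set E} := [set i | (X i != szero) && (X i == sopp (Y i))].
Definition svle X Y : bool := [forall i, (X i == szero) || (X i == Y i)].

Record oriented_matroid L : Prop := OrientedMatroid {
  om_zero : sv0 \in L;
  om_opp : forall X, X \in L -> svopp X \in L;
  om_comp : forall X Y, X \in L -> Y \in L -> svcomp X Y \in L;
  om_elim : forall X Y i, X \in L -> Y \in L -> i \in sep X Y ->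
    exists Z, [/\ Z \in L, Z i = szero &
      forall j, j \notin sep X Y ->
        Z j = svcomp X Y j /\ Z j = svcomp Y X j] }.

Definition affine_oriented_matroid L g : Prop :=
  oriented_matroid L /\ exists2 X, X \in L & X g != szero.

Definition positive_part L g : {set signvec E} :=
  [set X in L | X g == splus].

Definition cocircuits L : {set signvec E} :=
  [set X in L | (X != sv0) &&
    [forall Y in L, (Y != sv0) && svle Y X ==> (Y == X)]].

(* The zero covector is vacuously bounded; in the face poset of the bounded
   complex, ordered by svle, it is the empty cell. *)
Definition bounded_covectors L g : {set signvec E} :=
  [set X in L |
    [forall Y in L, (Y != sv0) && svle Y X ==> (Y \in positive_part L g)]].

Definition bounded_vertices L g : {set signvec E} :=
  cocircuits L :&: positive_part L g.

End OrientedMatroids.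

Section MonomialIdeals.

Variables (k : fieldType) (N : nat).
Implicit Types (T : finType) (I : {mpoly k[N]} -> Prop).

Definition monomial_ideal T (A : {set T}) (lab : T -> 'X_{1..N})
    (p : {mpoly k[N]}) : Prop :=
  exists a : T -> {mpoly k[N]}, p = \sum_(t in A) a t * 'X_[lab t].

Definition generated_by T I (A : {set T}) (lab : T -> 'X_{1..N}) : Prop :=
  forall p, I p <-> monomial_ideal A lab p.

Definition minimally_generated_by T I (A : {set T}) (lab : T -> 'X_{1..N}) :
    Prop :=
  generated_by I A lab /\
  forall A' : {set T}, A' \proper A -> ~ generated_by I A' lab.

End MonomialIdeals.

(* A finite regular CW complex is represented by its face poset: the set D of
   its cells, the empty cell included, ordered by le. *)
Section CellComplexes.

Variables (T : finType) (le : rel T) (D : {set T}).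

Definition is_chain (C : {set T}) : bool :=
  [forall x in C, forall y in C, le x y || le y x].

(* The length of a longest chain of cells ending at c. In the face poset of a
   regular CW complex this is dim c + 1: 0 for the empty cell, 1 for the
   vertices. Homological degrees are shifted by one accordingly. *)
Definition crank (c : T) : nat :=
  \max_(C : {set T} |
        (C \subset [set x in D | le x c & x != c]) && is_chain C) #|C|.

Definition facet (c' c : T) : bool :=
  [&& c' \in D, c \in D, le c' c & crank c == (crank c').+1].

(* Incidence numbers [c : c'] = inc c c' of a regular CW complex, augmented by
   [v : empty cell] = 1. These axioms determine them up to a choice of the
   orientations of the cells. *)
Record incidence_function (inc : T -> T -> int) : Prop := IncidenceFunction {
  inc_facet : forall c c', facet c' c -> inc c c' = 1 \/ inc c c' = -1;
  inc_nonfacet : forall c c', ~~ facet c' c -> inc c c' = 0;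
  inc_vertex : forall v e, facet e v -> crank e = 0%N -> inc v e = 1;
  inc_sum0 : forall c c'', \sum_(c' in D) inc c c' * inc c' c'' = 0 }.

Variable inc : T -> T -> int.

Definition boundary (A : nzRingType) (f : {ffun T -> A}) : {ffun T -> A} :=
  [ffun c' => \sum_(c in D) (inc c c')%:~R * f c].

(* The augmented cellular chains, with coefficients in k, of the subcomplex
   with set of cells A. *)
Definition cellular_chain (k : fieldType) (A : {set T}) (r : nat)
    (f : {ffun T -> k}) : Prop :=
  forall c, f c != 0 -> c \in A /\ crank c = r.

Definition acyclic (k : fieldType) (A : {set T}) : Prop :=
  forall r (f : {ffun T -> k}), cellular_chain A r f -> boundary f = 0 ->
  exists2 h : {ffun T -> k}, cellular_chain A r.+1 h & boundary h = f.

Variables (k : fieldType) (N : nat) (lab : T -> 'X_{1..N}).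

Definition complex_vertices : {set T} := [set v in D | crank v == 1%N].

Definition cell_label (c : T) : 'X_{1..N} :=
  \big[@mlcm N/0%MM]_(v in complex_vertices | le v c) lab v.

Definition sublevel (m : 'X_{1..N}) : {set T} :=
  [set c in D | (cell_label c <= m)%MM].

Record ideal_complex (I : {mpoly k[N]} -> Prop) : Prop := IdealComplex {
  icx_gen : generated_by I complex_vertices lab;
  icx_acyclic : forall m,
    (exists2 c, c \in sublevel m & (0 < crank c)%N) -> acyclic k (sublevel m);
  (* Only nonempty faces c' are meant: when I is the unit ideal a vertex may
     have the label 1 of the empty cell. *)
  icx_label : forall c c', c \in D -> c' \in D -> (0 < crank c')%N ->
    le c' c -> c' != c -> cell_label c <> cell_label c' }.

(* The module C_(r - 1), the direct sum of the principal ideals <m_c> over the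
   cells c with crank c = r, inside the functions from cells to the polynomial
   ring; the differential is boundary. *)
Definition cellular_module (r : nat) (f : {ffun T -> {mpoly k[N]}}) : Prop :=
  forall c, (exists q, f c = q * 'X_[cell_label c]) /\
            (f c != 0 -> c \in D /\ crank c = r).

End CellComplexes.

(* Complexes of submodules of the module of functions from T to S = k[N],
   N^N-graded componentwise. *)
Section Resolutions.

Variables (k : fieldType) (N : nat) (T : finType).
Let S := {mpoly k[N]}.
Implicit Types (M : {ffun T -> S} -> Prop) (f : {ffun T -> S}).

Definition homogeneous_poly (a : 'X_{1..N}) (p : S) : Prop :=
  exists x : k, p = x *: 'X_[a].

Definition homogeneous (a : 'X_{1..N}) f : Prop :=
  forall c, homogeneous_poly a (f c).

Definition graded_free M : Prop :=
  exists (r : nat) (b : 'I_r -> {ffun T -> S}),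
    (forall j, exists a, homogeneous a (b j)) /\
    (forall f, M f <-> exists! s : {ffun 'I_r -> S},
        f = [ffun c => \sum_j s j * b j c]).

(* The product of M by the maximal ideal generated by the variables. *)
Definition maxideal_mul M f : Prop :=
  exists h : 'I_N -> {ffun T -> S},
    (forall j, M (h j)) /\ f = [ffun c => \sum_j 'X_j * h j c].

Record minimal_graded_free_resolution (F : nat -> {ffun T -> S} -> Prop)
    (d : {ffun T -> S} -> {ffun T -> S}) (aug : {ffun T -> S} -> S)
    (I : S -> Prop) : Prop := MinimalGradedFreeResolution {
  res_free : forall i, graded_free (F i);
  res_map : forall i f, F i.+1 f -> F i (d f);
  res_graded : forall i a f,
    F i.+1 f -> homogeneous a f -> homogeneous a (d f);
  res_aug_graded : forall a f,
    F 0%N f -> homogeneous a f -> homogeneous_poly a (aug f);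
  res_exact : forall i f, F i.+1 f ->
    (d f = 0 <-> exists2 h, F i.+2 h & d h = f);
  res_exact0 : forall f, F 0%N f ->
    (aug f = 0 <-> exists2 h, F 1%N h & d h = f);
  res_image : forall p, I p <-> exists2 f, F 0%N f & aug f = p;
  res_minimal : forall i f, F i.+1 f -> maxideal_mul (F i) (d f) }.

End Resolutions.

(* The ground set is E = option 'I_n, with g = None. In k[n + n] the variable
   x_i has index lshift n i and y_i has index rshift n i. *)
Section OrientedMatroidIdeal.

Variables (k : fieldType) (n : nat).
Implicit Types (Z : signvec (option 'I_n)) (L : {set signvec (option 'I_n)}).

Definition xvar (e : option 'I_n) : 'X_{1..n + n} :=
  if e is Some i then U_(lshift n i)%MM else 0%MM.
Definition yvar (e : option 'I_n) : 'X_{1..n + n} :=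
  if e is Some i then U_(rshift n i)%MM else 0%MM.

Definition mxy Z : 'X_{1..n + n} :=
  (\sum_(e | Z e == splus) xvar e + \sum_(e | Z e == sminus) yvar e)%MM.

Definition om_ideal L : {mpoly k[n + n]} -> Prop :=
  monomial_ideal (positive_part L None) mxy.

End OrientedMatroidIdeal.

Arguments om_ideal k {n} L p.

(* Main.v *)
From HB Require Import structures.
Require Import Defs.

(* The sublevel complex of a monomial consists of the bounded covectors lying in
   prescribed closed half-spaces. Mayer-Vietoris along hyperplanes reduces its
   acyclicity to the bounded faces of a single covector T. These form one fibre
   of the map sending a face X of T to its largest face at infinity; all fibres
   are acyclic by downward induction, because the intervals [U, T] are.

   Intervals are handled by a sweep (a line shelling without coordinates): a
   covector V moving from T to -T crosses the hyperplanes one parallel class at a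
   time, and each crossing removes from the faces of T those lying on one proper
   face of T but on no hyperplane crossed before, a set of the same kind in lower
   dimension. Stopping just before the last facet G shows that the boundary of T
   without G is acyclic over the integers, so the facets of T carry a cycle,
   unique up to sign, with coefficients +1 and -1. This cycle gives the incidence
   numbers of T, whence any incidence function on the bounded complex extends to
   all covectors, in particular to unbounded ones, where the intervals live.

   The resolution is then obtained degree by degree. *)

Set Implicit Arguments.
Unset Strict Implicit.
Unset Printing Implicit Defensive.

Import GRing.Theory.

(** * Ranks in finite posets *)

Definition partial_order (T : Type) (le : rel T) : Prop :=
  [/\ reflexive le, antisymmetric le & transitive le].

Lemma minimal_below (T : finType) (le : rel T) (A : {set T}) x :
    partial_order le -> x \in A ->
  exists y, [/\ y \in A, le y x & {in A, forall z, le z y -> z = y}].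
Proof.
move=> [le_refl le_anti le_trans] xA.
pose P y := (y \in A) && le y x; pose size y := #|[set z | le z y]|.
have Px : P x by rewrite /P xA le_refl.
case: (@arg_minnP _ x P size Px) => y /andP[yA yx] size_min.
exists y; split=> // z zA zy; apply/eqP; apply: contraT => nzy.
have := size_min z; rewrite /P zA (le_trans _ _ _ zy yx) leqNgt => /(_ isT)/negP[].
apply: proper_card; apply/properP; split.
  by apply/subsetP => t; rewrite !inE => /le_trans; apply.
exists y; rewrite !inE ?le_refl //.
by apply: contra nzy => yz; apply/eqP/le_anti; rewrite zy.
Qed.

Lemma maximal_above (T : finType) (le : rel T) (A : {set T}) x :
    partial_order le -> x \in A ->
  exists y, [/\ y \in A, le x y & {in A, forall z, le y z -> z = y}].
Proof.
move=> [le_refl le_anti le_trans].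
apply: (minimal_below (le := fun y z => le z y)); split.
- exact: le_refl.
- by move=> y z /andP[zy yz]; apply: le_anti; rewrite yz.
- by move=> y z t yz ty; apply: le_trans ty yz.
Qed.

Section ChainRank.

Variables (T : finType) (le : rel T) (D : {set T}).
Hypothesis le_order : partial_order le.
Implicit Types (C : {set T}) (c x : T).

Let below c := [set x in D | le x c & x != c].

Lemma crank_attained c : exists C,
  [/\ C \subset below c, is_chain le C & crank le D c = #|C|].
Proof.
pose A := [set C : {set T} | (C \subset below c) && is_chain le C].
have A0 : 0 < #|A|.
  apply/card_gt0P; exists set0; rewrite inE sub0set.
  by apply/forall_inP => x; rewrite inE.
have [C] := eq_bigmax_cond (fun C : {set T} => #|C|) A0.
rewrite inE => /andP[sC chC] E; exists C; split=> //.
by rewrite /crank -E; apply: eq_bigl => C'; rewrite inE.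
Qed.

Lemma leq_card_crank C c :
  C \subset below c -> is_chain le C -> #|C| <= crank le D c.
Proof.
move=> sC chC; apply: (@leq_bigmax_cond _ _ (fun C : {set T} => #|C|)).
exact/andP.
Qed.

Lemma is_chainS C C' : C \subset C' -> is_chain le C' -> is_chain le C.
Proof.
move=> /subsetP sCC' /forall_inP chC'; apply/forall_inP => x /sCC' xC'.
by apply/forall_inP => y /sCC' yC'; apply: (forall_inP (chC' x xC')).
Qed.

Lemma is_chainU1 C x :
  is_chain le C -> (forall y, y \in C -> le y x) -> is_chain le (x |: C).
Proof.
move=> /forall_inP chC leCx; apply/forall_inP => y yC; apply/forall_inP => z zC.
case/setU1P: yC => [->|yC]; case/setU1P: zC => [->|zC].
- by have [-> _ _] := le_order.
- by rewrite leCx // orbT.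
- by rewrite leCx.
- exact: (forall_inP (chC y yC)).
Qed.

Lemma crank_lt x c :
  x \in D -> le x c -> x != c -> crank le D x < crank le D c.
Proof.
move=> xD xc nxc; have [_ le_anti le_trans] := le_order.
have [C [/subsetP sC chC ->]] := crank_attained x.
have xnC : x \notin C by apply/negP => /sC; rewrite inE eqxx !andbF.
rewrite -[#|C|.+1]/(true + #|C|) -xnC -cardsU1.
apply: leq_card_crank; last first.
  by apply: is_chainU1 => // y /sC; rewrite inE => /and3P[].
apply/subsetP => y /setU1P[->|/sC]; first by rewrite inE xD xc.
rewrite !inE => /and3P[-> yx nyx]; rewrite (le_trans _ _ _ yx xc) /=.
by apply: contraNneq nyx => yc; apply/eqP/le_anti; rewrite yx yc xc.
Qed.

Lemma crank_le x c : x \in D -> le x c -> crank le D x <= crank le D c.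
Proof.
by move=> xD xc; have [->//|nxc] := eqVneq x c; apply/ltnW/crank_lt.
Qed.

Lemma crank_pred c : 0 < crank le D c ->
  exists x, [/\ x \in D, le x c, x != c & crank le D c = (crank le D x).+1].
Proof.
have [C [sC chC eC]] := crank_attained c; rewrite eC => /card_gt0P[x0 x0C].
have [x [xC _ xmax]] := maximal_above le_order x0C.
have leCx y : y \in C -> le y x.
  move=> yC; have /orP[//|xy] := forall_inP (forall_inP chC y yC) x xC.
  by rewrite (xmax y) //; have [-> _ _] := le_order.
have /[!inE]/and3P[xD xc nxc] := subsetP sC x xC.
exists x; split=> //; apply/eqP; rewrite -eC eqn_leq crank_lt // andbT.
rewrite eC (cardsD1 x) xC ltnS.
apply: leq_card_crank; last by apply: is_chainS chC; apply: subsetDl.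
apply/subsetP => y /setD1P[nyx yC]; rewrite inE nyx leCx //= andbT.
by have /[!inE]/and3P[] := subsetP sC y yC.
Qed.

Lemma crank_eq0 o c : o \in D -> (forall x, x \in D -> le o x) -> c \in D ->
  (crank le D c == 0) = (c == o).
Proof.
move=> oD o_le cD; apply/eqP/eqP => [c0|->].
  have [//|noc] := eqVneq o c.
  by have := crank_lt oD (o_le c cD) noc; rewrite c0.
have [//|/crank_pred[x [xD xo nxo _]]] := posnP (crank le D o).
have [_ le_anti _] := le_order.
by case/eqP: nxo; apply: le_anti; rewrite xo o_le.
Qed.

End ChainRank.

(** * Exact subquotients of a cellular complex *)

Section Ideals.

Variables (T : finType) (le : rel T).
Implicit Types (P Q I D : {set T}).

Definition order_ideal Q I : Prop :=
  I \subset Q /\ forall x y, x \in Q -> y \in I -> le x y -> x \in I.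

Definition order_convex D Q : Prop := forall a b x,
  a \in Q -> b \in Q -> x \in D -> le a x -> le x b -> x \in Q.

Lemma order_ideal_convex D Q I :
  order_convex D Q -> order_ideal Q I -> order_convex D I.
Proof.
move=> cvQ [/subsetP sIQ idI] a b x aI bI xD ax xb.
by apply: (idI x b) => //; apply: (cvQ a b); rewrite ?sIQ.
Qed.

Lemma order_convexD D Q I :
  order_convex D Q -> order_ideal Q I -> order_convex D (Q :\: I).
Proof.
move=> cvQ [_ idI] a b x /setDP[aQ aI] /setDP[bQ _] xD ax xb.
have xQ : x \in Q by apply: (cvQ a b).
by rewrite inE xQ andbT; apply: contra aI => xI; apply: idI ax.
Qed.

Lemma order_idealS P Q I :
  I \subset P -> P \subset Q -> order_ideal Q I -> order_ideal P I.
Proof. by move=> sIP /subsetP sPQ [_ idI]; split=> // x y /sPQ; apply: idI. Qed.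

Lemma order_idealU Q I J :
  order_ideal Q I -> order_ideal Q J -> order_ideal Q (I :|: J).
Proof.
move=> [sIQ idI] [sJQ idJ]; split; first by rewrite subUset sIQ.
by move=> x y xQ /setUP[/idI|/idJ] xy yx; rewrite inE xy ?orbT.
Qed.

Lemma order_idealI Q I J :
  order_ideal Q I -> order_ideal Q J -> order_ideal Q (I :&: J).
Proof.
move=> [sIQ idI] [_ idJ]; split; first exact: subset_trans (subsetIl _ _) sIQ.
by move=> x y xQ /setIP[/idI yI /idJ yJ] xy; rewrite inE yI // yJ.
Qed.

End Ideals.

Section Chains.

Local Open Scope ring_scope.

Variables (T : finType) (D : {set T}) (inc : T -> T -> int) (A : nzRingType).
Implicit Types (f h u : {ffun T -> A}) (P Q : {set T}).

Notation bd := (boundary D inc (A := A)).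

Lemma boundary_is_zmod_morphism : zmod_morphism bd.
Proof.
move=> f h; apply/ffunP => c; rewrite !ffunE -sumrB; apply: eq_bigr => x _.
by rewrite !ffunE mulrBr.
Qed.

HB.instance Definition _ :=
  GRing.isZmodMorphism.Build _ _ bd boundary_is_zmod_morphism.

Definition restrict Q f : {ffun T -> A} := [ffun c => if c \in Q then f c else 0].

Lemma restrict_is_zmod_morphism Q : zmod_morphism (restrict Q).
Proof.
by move=> f h; apply/ffunP => c; rewrite !ffunE; case: ifP; rewrite ?subr0.
Qed.

HB.instance Definition _ Q :=
  GRing.isZmodMorphism.Build _ _ (restrict Q) (restrict_is_zmod_morphism Q).

Definition boundary_on Q f : {ffun T -> A} := restrict Q (bd f).

Lemma boundary_on_is_zmod_morphism Q : zmod_morphism (boundary_on Q).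
Proof. by move=> f h; rewrite /boundary_on !raddfB. Qed.

HB.instance Definition _ Q :=
  GRing.isZmodMorphism.Build _ _ (boundary_on Q) (boundary_on_is_zmod_morphism Q).

Definition chain_on Q f : Prop := forall c, c \notin Q -> f c = 0.

Definition exact_on Q : Prop := forall f, chain_on Q f -> boundary_on Q f = 0 ->
  exists2 h, chain_on Q h & boundary_on Q h = f.

Lemma chain_on_restrict Q f : chain_on Q (restrict Q f).
Proof. by move=> c /negPf Qc; rewrite ffunE Qc. Qed.

Lemma restrict_id Q f : chain_on Q f -> restrict Q f = f.
Proof.
by move=> Qf; apply/ffunP => c; rewrite ffunE; case: ifP => // /negbT/Qf ->.
Qed.

Lemma restrict_restrict P Q f : restrict P (restrict Q f) = restrict (P :&: Q) f.
Proof. by apply/ffunP => c; rewrite !ffunE inE; case: (c \in P). Qed.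

Lemma restrict_splitC Q f : f = restrict Q f + restrict (~: Q) f.
Proof.
by apply/ffunP => c; rewrite !ffunE in_setC; case: (c \in Q); rewrite ?addr0 ?add0r.
Qed.

Lemma chain_on_mem Q f c : chain_on Q f -> f c != 0 -> c \in Q.
Proof. by move=> Qf; apply: contraR => /Qf ->. Qed.

Lemma chain_on_neq0 Q f : (forall c, f c != 0 -> c \in Q) -> chain_on Q f.
Proof. by move=> fQ c cQ; apply/eqP; apply: contraR cQ => /fQ. Qed.

Lemma chain_onS P Q f : P \subset Q -> chain_on P f -> chain_on Q f.
Proof. by move=> /subsetP sPQ Pf c cQ; apply: Pf; apply: contra cQ; apply: sPQ. Qed.

Lemma chain_onB Q f h : chain_on Q f -> chain_on Q h -> chain_on Q (f - h).
Proof. by move=> Qf Qh c cQ; rewrite !ffunE Qf ?Qh ?subr0. Qed.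

Lemma chain_onD Q f h : chain_on Q f -> chain_on Q h -> chain_on Q (f + h).
Proof. by move=> Qf Qh c cQ; rewrite !ffunE Qf ?Qh ?addr0. Qed.

Lemma chain_on_diff Q I f :
  chain_on Q f -> restrict (Q :\: I) f = 0 -> chain_on I f.
Proof.
move=> Qf /ffunP f0 c cI; have [cQ|/Qf //] := boolP (c \in Q).
by have := f0 c; rewrite !ffunE inE cI cQ.
Qed.

Lemma restrict_diff0 Q I f : chain_on I f -> restrict (Q :\: I) f = 0.
Proof.
by move=> If; apply/ffunP => c; rewrite !ffunE; case: ifP => // /setDP[_ /If].
Qed.

Lemma boundary_neq0 f c' : bd f c' != 0 ->
  exists c, [/\ c \in D, f c != 0 & inc c c' != 0].
Proof.
move=> nz; have /exists_inP[c cD /andP[fc ic]] :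
    [exists c in D, (f c != 0) && (inc c c' != 0)].
  apply: contraNT nz => /exists_inPn H; rewrite ffunE big1 // => c /H.
  by rewrite negb_and !negbK => /orP[]/eqP ->; rewrite ?mulr0 ?mulr0z ?mul0r.
by exists c.
Qed.

Lemma exact_on_set0 : exact_on set0.
Proof.
move=> f f0 _; exists 0; first by move=> c _; rewrite ffunE.
by apply/ffunP => c; rewrite raddf0 ffunE f0 ?inE.
Qed.

End Chains.

Lemma eq_exact_on (T : finType) (D D' : {set T}) (inc inc' : T -> T -> int)
    (A : nzRingType) (Q : {set T}) :
    D \subset D' -> Q \subset D -> {in D, inc' =1 inc} ->
  exact_on D' inc' A Q -> exact_on D inc A Q.
Proof.
move=> /subsetP sDD' /subsetP sQD einc ex.
have bdE (f : {ffun T -> A}) : chain_on Q f ->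
    boundary_on D inc Q f = boundary_on D' inc' Q f.
  move=> Qf; congr restrict; apply/ffunP => c'.
  rewrite !ffunE [LHS]big_mkcond [RHS]big_mkcond; apply: eq_bigr => c _.
  have [cD|cD] := boolP (c \in D); first by rewrite sDD' // einc.
  by rewrite Qf ?mulr0 ?if_same // (contra (sQD c)).
move=> f Qf; rewrite bdE // => /(ex f Qf)[h Qh <-].
by exists h; rewrite ?bdE.
Qed.

Section SubquotientComplexes.

Local Open Scope ring_scope.

Variables (T : finType) (le : rel T) (D : {set T}) (inc : T -> T -> int).
Hypothesis hinc : incidence_function le D inc.
Variable A : nzRingType.
Implicit Types (f h u : {ffun T -> A}) (P Q I J : {set T}).

Notation bd := (boundary D inc (A := A)).
Notation bd_on := (boundary_on D inc (A := A)).
Notation exact_cells := (exact_on D inc A).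
Notation convex := (order_convex le D).
Notation ideal := (order_ideal le).

Lemma inc_neq0_facet c c' : inc c c' != 0 -> facet le D c' c.
Proof. by apply: contraNT => /(inc_nonfacet hinc) ->. Qed.

Lemma boundary_neq0_facet f c' :
  bd f c' != 0 -> exists2 c, f c != 0 & facet le D c' c.
Proof. by case/boundary_neq0 => c [_ fc /inc_neq0_facet]; exists c. Qed.

Lemma boundary_boundary f : bd (bd f) = 0.
Proof.
apply/ffunP => c''; rewrite !ffunE.
under eq_bigr => c' _ do rewrite ffunE mulr_sumr.
rewrite exchange_big /= big1 // => c _.
under eq_bigr => c' _ do rewrite mulrA -intrM [inc c' c'' * _]mulrC.
by rewrite -mulr_suml -raddf_sum /= (inc_sum0 hinc) mulr0z mul0r.
Qed.

Lemma boundary_on_boundary_on Q f : convex Q -> chain_on Q f ->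
  bd_on Q (bd_on Q f) = 0.
Proof.
move=> cvQ Qf; have /eqP := boundary_boundary f.
rewrite {1}(restrict_splitC Q (bd f)) raddfD addr_eq0 => /eqP bdE.
rewrite /boundary_on bdE raddfN; apply/eqP; rewrite oppr_eq0; apply/eqP/ffunP => c.
rewrite [RHS]ffunE [LHS]ffunE; case: ifP => // cQ; apply/eqP; apply: contraTT cQ.
case/boundary_neq0_facet => x; rewrite ffunE in_setC.
case: ifP => [xQ|_]; last by rewrite eqxx.
case/boundary_neq0_facet => y /(chain_on_mem Qf) yQ.
move=> /and4P[xD _ xy _] /and4P[_ _ cx _].
by apply: contra xQ => cQ; apply: (cvQ c y).
Qed.

Lemma boundary_on_ideal0 Q I f :
  ideal Q I -> chain_on I f -> bd_on (Q :\: I) f = 0.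
Proof.
move=> [_ idI] fI; apply/ffunP => c; rewrite [RHS]ffunE; apply/eqP.
apply: contraT; rewrite ffunE; case: ifP => [/setDP[cQ cI]|]; last by rewrite eqxx.
case/boundary_neq0_facet => x /(chain_on_mem fI) xI /and4P[_ _ cx _].
by case/negP: cI; apply: idI cx.
Qed.

Lemma boundary_on_ideal Q I f :
  ideal Q I -> chain_on I f -> bd_on Q f = bd_on I f.
Proof.
move=> idI If; have [sIQ _] := idI.
apply/ffunP => c; have /ffunP/(_ c) := boundary_on_ideal0 idI If.
rewrite !ffunE inE; have [/(subsetP sIQ) -> //|_ /= ->] := boolP (c \in I).
by [].
Qed.

Lemma boundary_on_quot Q I f : ideal Q I -> chain_on Q f ->
  restrict (Q :\: I) (bd_on Q f) =
  bd_on (Q :\: I) (restrict (Q :\: I) f).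
Proof.
move=> idI Qf; rewrite restrict_restrict (setIidPl (subsetDl Q I)).
rewrite -/(bd_on _ _) {1}(restrict_splitC I f) raddfD /=.
rewrite (boundary_on_ideal0 idI) ?add0r.
  by rewrite -{1}(restrict_id Qf) restrict_restrict setIC -setDE.
exact: chain_on_restrict.
Qed.

Lemma exact_on_glue Q I : convex Q -> ideal Q I ->
  exact_cells I -> exact_cells (Q :\: I) -> exact_cells Q.
Proof.
move=> cvQ idI exI exJ f Qf f0; have [sIQ _] := idI.
have [|h Jh hE] := exJ _ (@chain_on_restrict _ _ (Q :\: I) f).
  by rewrite -boundary_on_quot // f0 raddf0.
have Qh : chain_on Q h := chain_onS (subsetDl Q I) Jh.
have Qbh : chain_on Q (bd_on Q h) by apply: chain_on_restrict.
have Idiff : chain_on I (f - bd_on Q h).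
  apply: (@chain_on_diff _ _ Q); first exact: chain_onB.
  by rewrite raddfB /= boundary_on_quot // (restrict_id Jh) hE subrr.
have [|u Iu uE] := exI _ Idiff.
  rewrite -(boundary_on_ideal idI) // raddfB /= f0.
  by rewrite boundary_on_boundary_on // subr0.
exists (h + u); first by apply: chain_onD => //; apply: chain_onS Iu.
by rewrite raddfD /= (boundary_on_ideal idI Iu) uE addrC subrK.
Qed.

Lemma exact_on_sub Q I : convex Q -> ideal Q I ->
  exact_cells Q -> exact_cells (Q :\: I) -> exact_cells I.
Proof.
move=> cvQ idI exQ exJ f If f0; have [sIQ _] := idI.
have [|h Qh hE] := exQ f (chain_onS sIQ If).
  by rewrite (boundary_on_ideal idI).
have [|u Ju uE] := exJ _ (@chain_on_restrict _ _ (Q :\: I) h).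
  by rewrite -boundary_on_quot // hE (restrict_diff0 _ If).
have Qu : chain_on Q u := chain_onS (subsetDl Q I) Ju.
have Ih : chain_on I (h - bd_on Q u).
  apply: (@chain_on_diff _ _ Q).
    by apply: chain_onB; last exact: chain_on_restrict.
  by rewrite raddfB /= boundary_on_quot // (restrict_id Ju) uE subrr.
exists (h - bd_on Q u) => //.
rewrite -(boundary_on_ideal idI) // raddfB /= hE.
by rewrite boundary_on_boundary_on // subr0.
Qed.

Lemma exact_on_quot Q I : convex Q -> ideal Q I ->
  exact_cells Q -> exact_cells I -> exact_cells (Q :\: I).
Proof.
move=> cvQ idI exQ exI f Jf f0; have [sIQ _] := idI.
have Qf : chain_on Q f := chain_onS (subsetDl Q I) Jf.
have Ibf : chain_on I (bd_on Q f).
  apply: (@chain_on_diff _ _ Q); first exact: chain_on_restrict.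
  by rewrite boundary_on_quot // restrict_id.
have [|h Ih hE] := exI _ Ibf.
  by rewrite -(boundary_on_ideal idI) // boundary_on_boundary_on.
have Qfh : chain_on Q (f - h) by apply: chain_onB => //; apply: chain_onS Ih.
have [|u Qu uE] := exQ _ Qfh.
  by rewrite raddfB /= (boundary_on_ideal idI Ih) hE subrr.
exists (restrict (Q :\: I) u); first exact: chain_on_restrict.
rewrite -boundary_on_quot // uE raddfB /= (restrict_id Jf).
by rewrite (restrict_diff0 _ Ih) subr0.
Qed.

Lemma exact_on_setU I J : ideal D I -> ideal D J ->
  exact_cells I -> exact_cells J -> exact_cells (I :&: J) -> exact_cells (I :|: J).
Proof.
move=> idI idJ exI exJ exIJ.
have convex_ideal P : ideal D P -> convex P by apply: order_ideal_convex.
have [sIJD _] := order_idealU idI idJ.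
apply: (exact_on_glue _ _ exI).
- exact/convex_ideal/order_idealU.
- by apply: (order_idealS _ sIJD idI); apply: subsetUl.
have -> : (I :|: J) :\: I = J :\: (I :&: J).
  by rewrite setDUl setDIr !setDv set0U setU0.
apply: exact_on_quot => //; first exact: convex_ideal.
apply: order_idealS (order_idealI idI idJ); first exact: subsetIr.
by case: idJ.
Qed.

Lemma exact_on_facet_pair a b : facet le D a b -> exact_cells [set a; b].
Proof.
move=> ab; have [_ bD _ /eqP rb] := and4P ab.
have inc_a0 c : c \in [set a; b] -> inc a c = 0.
  move=> cab; apply/eqP; apply: contraT => /inc_neq0_facet/and4P[_ _ _ /eqP ra].
  case/set2P: cab ra => ->; first by move/n_Sn.
  by rewrite rb => ra; have := leqnSn (crank le D a).+1; rewrite -ra ltnn.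
have inc_b0 : inc b b = 0.
  by apply/eqP; apply: contraT => /inc_neq0_facet/and4P[_ _ _ /eqP/n_Sn].
have sq1 : inc b a * inc b a = 1 by case: (inc_facet hinc ab) => ->.
have bdE h c : chain_on [set a; b] h -> c \in [set a; b] ->
    bd h c = (inc b c)%:~R * h b.
  move=> hab cab; rewrite ffunE (bigD1 b) //= big1 ?addr0 // => x /andP[_ nxb].
  have [->|nxa] := eqVneq x a; first by rewrite inc_a0 // mul0r.
  by rewrite hab ?mulr0 // !inE negb_or nxa.
move=> f fab /ffunP f0.
have fb0 : f b = 0.
  have := f0 a; rewrite [LHS]ffunE [RHS]ffunE set21 bdE ?set21 //.
  by move=> /(congr1 ( *%R (inc b a)%:~R)); rewrite mulr0 mulrA -intrM sq1 mul1r.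
exists [ffun c => if c == b then (inc b a)%:~R * f a else 0].
  by move=> c; rewrite !inE ffunE => /norP[_ /negPf ->].
apply/ffunP => c; rewrite ffunE; case: ifP => [cab|/negbT/fab //].
rewrite bdE // ?ffunE ?eqxx.
  by case/set2P: cab => ->; rewrite ?inc_b0 ?mul0r ?fb0 // mulrA -intrM sq1 mul1r.
by move=> x; rewrite !inE ffunE => /norP[_ /negPf ->].
Qed.

Lemma exact_on_fibres (T' : finType) (le' : rel T') (phi : T -> T') Q :
    partial_order le' -> convex Q ->
    {in Q &, {homo phi : x y / le x y >-> le' x y}} ->
    {in Q, forall x, exact_cells [set y in Q | phi y == phi x]} ->
  exact_cells Q.
Proof.
move=> le'_order; have [m] := ubnP #|Q|.
elim: m Q => // m IH Q /ltnSE leQ cvQ mono fib.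
have [->|/set0Pn[x0 x0Q]] := eqVneq Q set0; first exact: exact_on_set0.
have [_ [/imsetP[x xQ ->] _ xmin]] := minimal_below le'_order (imset_f phi x0Q).
pose I := [set y in Q | phi y == phi x].
have idI : ideal Q I.
  split; first by apply/subsetP => y; rewrite inE => /andP[].
  move=> y z yQ; rewrite !inE => /andP[zQ /eqP zx] yz; rewrite yQ -zx /=.
  by apply/eqP; rewrite zx; apply: xmin; [apply: imset_f|rewrite -zx; apply: mono].
apply: (exact_on_glue cvQ idI); first exact: fib.
apply: IH.
- apply: leq_trans leQ; apply/proper_card/properP; split; first exact: subsetDl.
  by exists x => //; rewrite !inE xQ eqxx.
- exact: order_convexD.
- by move=> y z /setDP[yQ _] /setDP[zQ _]; apply: mono.
move=> y /setDP[yQ yI]; have := fib y yQ; congr exact_on.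
apply/setP => z; rewrite !inE; case: (z \in Q); rewrite ?andbF //= andbT.
have [->|] := eqVneq (phi z) (phi y); rewrite ?andbF ?andbT //.
by move: yI; rewrite inE yQ => ->.
Qed.

Definition cells_of_rank r : {set T} := [set c | crank le D c == r].

Lemma boundary_restrict_rank r f :
  bd (restrict (cells_of_rank r) f) =
  restrict [set c | (crank le D c).+1 == r] (bd f).
Proof.
apply/ffunP => c'; rewrite !ffunE inE.
under eq_bigr => c _ do rewrite ffunE inE.
have [<-|nr] := eqVneq (crank le D c').+1 r.
  apply: eq_bigr => c _; case: eqP => // nrc.
  have [->|/inc_neq0_facet/and4P[_ _ _ /eqP //]] := eqVneq (inc c c') 0.
  by rewrite mulr0z !mul0r.
rewrite big1 // => c _; case: eqP => [rc|_]; last by rewrite mulr0.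
have [->|/inc_neq0_facet/and4P[_ _ _]] := eqVneq (inc c c') 0.
  by rewrite mulr0z mul0r.
by rewrite rc eq_sym (negPf nr).
Qed.

Lemma exact_on_homogeneous Q r f :
    exact_cells Q -> chain_on Q f ->
    (forall c, f c != 0 -> (crank le D c).+1 = r) -> bd_on Q f = 0 ->
  exists h, [/\ chain_on Q h, chain_on (cells_of_rank r) h & bd_on Q h = f].
Proof.
move=> exQ Qf fr f0; have [h Qh hE] := exQ f Qf f0.
exists (restrict (cells_of_rank r) h); split; last 1 first.
- rewrite /boundary_on boundary_restrict_rank restrict_restrict setIC.
  rewrite -restrict_restrict -/(bd_on _ _) hE restrict_id //.
  apply: chain_on_neq0 => c /fr rc.
  by rewrite inE rc.
- by move=> c cQ; rewrite ffunE Qh // if_same.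
exact: chain_on_restrict.
Qed.

Lemma chain_on_boundary Q f : ideal D Q -> chain_on Q f -> chain_on Q (bd f).
Proof.
move=> [_ idQ] Qf; apply: chain_on_neq0 => c'.
case/boundary_neq0_facet => c /(chain_on_mem Qf) cQ /and4P[c'D _ c'c _].
exact: idQ c'c.
Qed.

End SubquotientComplexes.

Lemma exact_on_acyclic (T : finType) (le : rel T) (D : {set T}) inc
    (k : fieldType) (Q : {set T}) :
    incidence_function le D inc -> order_ideal le D Q ->
  exact_on D inc k Q -> acyclic le D inc k Q.
Proof.
move=> hinc idQ exQ r f fQr f0.
have Qf : chain_on Q f by apply: chain_on_neq0 => c /fQr[].
have [||h [Qh hr hE]] := exact_on_homogeneous (r := r.+1) hinc exQ Qf.
- by move=> c /fQr[_ ->].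
- by rewrite /boundary_on f0 raddf0.
exists h.
  move=> c hc; split; first exact: chain_on_mem hc.
  by have := chain_on_mem hr hc; rewrite inE => /eqP.
by rewrite -hE /boundary_on restrict_id //; apply: (chain_on_boundary hinc).
Qed.

(** * Cellular resolutions *)

Section MonomialDivision.

Local Open Scope ring_scope.

Variables (k : fieldType) (N : nat).
Implicit Types (p q : {mpoly k[N]}) (m a b : 'X_{1..N}).

Lemma lepm_anti m a : (m <= a)%MM -> (a <= m)%MM -> m = a.
Proof.
move=> /mnm_lepP ma /mnm_lepP am; apply/mnmP => i.
by apply/eqP; rewrite eqn_leq ma am.
Qed.

Lemma mpolyX_neq0 m : 'X_[m] != 0 :> {mpoly k[N]}.
Proof. by rewrite -msupp_eq0 msuppX. Qed.

Lemma mcoeff_mulX_le p m a : (p * 'X_[m])@_a != 0 -> (m <= a)%MM.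
Proof.
rewrite -mcoeff_msupp (perm_mem (msuppMX p m)) => /mapP[b _ ->].
exact: lem_addr.
Qed.

(* Each term of p is assigned to one index i related to its exponent. *)
Lemma mpoly_sum_mulX (I : finType) (e : I -> 'X_{1..N})
    (R : I -> 'X_{1..N} -> bool) p :
    (forall i a, R i a -> (e i <= a)%MM) ->
    (forall a, p@_a != 0 -> exists i, R i a) ->
  exists q : I -> {mpoly k[N]}, p = \sum_i q i * 'X_[e i] /\
    forall i b, (q i)@_b != 0 -> R i (e i + b)%MM /\ p@_(e i + b) != 0.
Proof.
move=> Re Rp; pose term a := [pick i | R i a].
exists (fun i => \sum_(a <- msupp p | term a == Some i) p@_a *: 'X_[(a - e i)%MM]).
split.
  rewrite [LHS]mpolyE; under [RHS]eq_bigr do rewrite mulr_suml big_mkcond.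
  rewrite exchange_big /= big_seq [RHS]big_seq; apply: eq_bigr => a.
  rewrite mcoeff_msupp /term => /Rp[i0 Ri0].
  case: pickP => [i Ri|/(_ i0)/negP[] //].
  rewrite (bigD1 i) //= eqxx big1 ?addr0 => [|j nji]; last first.
    by case: eqP => // -[Eij]; rewrite Eij eqxx in nji.
  by rewrite -scalerAl -mpolyXD submK ?Re.
move=> i b; have [/hasP[a ap /andP[+ /eqP <-]]|/hasPn none] :=
  boolP (has (fun a => (term a == Some i) && (a - e i == b)%MM) (msupp p)).
  rewrite /term; case: pickP => // j Rj /eqP[<-] _.
  by rewrite addmC submK ?Re // -mcoeff_msupp.
rewrite raddf_sum big_seq_cond big1 ?eqxx //= => a /andP[/none + ta].
by rewrite ta mcoeffZ mcoeffX /= => /negPf ->; rewrite mulr0.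
Qed.

Lemma mulX_mcoeffP m p : (exists q, p = q * 'X_[m]) <->
  (forall a, p@_a != 0 -> (m <= a)%MM).
Proof.
split=> [[q ->] a|pm]; first exact: mcoeff_mulX_le.
pose R (_ : unit) a := (m <= a)%MM.
have [//|a pa|q [-> _]] := @mpoly_sum_mulX unit (fun=> m) R p.
  by exists tt; apply: pm.
by exists (q tt); rewrite (big_pred1 tt) // => -[].
Qed.

Lemma monomial_idealP (T : finType) (A : {set T}) lab p :
  monomial_ideal A lab p <->
  (forall a, p@_a != 0 -> exists2 t, t \in A & (lab t <= a)%MM).
Proof.
split=> [[q ->] a|pA].
  rewrite raddf_sum /= => nz.
  have /exists_inP[t tA /mcoeff_mulX_le ta] :
      [exists t in A, (q t * 'X_[lab t])@_a != 0].
    apply: contraNT nz => /exists_inPn none; rewrite big1 // => t /none.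
    by rewrite negbK => /eqP.
  by exists t.
pose R t a := (t \in A) && (lab t <= a)%MM.
have [||q [pE qP]] := @mpoly_sum_mulX T lab R p.
- by move=> t a /andP[].
- by move=> a /pA[t tA ta]; exists t; apply/andP.
exists q; rewrite [LHS]pE [RHS]big_mkcond; apply: eq_bigr => t _.
case: ifP => // /negP tA.
have -> : q t = 0; last exact: mul0r.
apply/mpolyP => b; rewrite mcoeff0; apply/eqP; apply: contraT.
by case/qP => /andP[].
Qed.

End MonomialDivision.

Section CellularResolution.

Local Open Scope ring_scope.

Variables (T : finType) (le : rel T) (D : {set T}) (inc : T -> T -> int).
Hypothesis le_order : partial_order le.
Hypothesis hinc : incidence_function le D inc.
Variables (k : fieldType) (N : nat) (lab : T -> 'X_{1..N}).

Notation bd := (boundary D inc).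
Notation lbl := (cell_label le D lab).
Notation rk := (crank le D).
Notation M := (cellular_module le D lab (k := k)).
Notation chains := {ffun T -> {mpoly k[N]}}.
Notation vertices := (complex_vertices le D).
Implicit Types (c v : T) (a m : 'X_{1..N}) (f h : chains).

Lemma cell_label_leP c m : reflect
  (forall v, v \in vertices -> le v c -> (lab v <= m)%MM) (lbl c <= m)%MM.
Proof.
pose divides (l : 'X_{1..N}) := (l <= m)%MM.
have -> : (lbl c <= m)%MM =
    [forall (v | (v \in vertices) && le v c), divides (lab v)].
  rewrite -big_andE; apply: (big_morph divides) => [l l'|]; first exact: lem_mlcm.
  by apply/mnm_lepP => i; rewrite mnm0E.
apply: (iffP forall_inP) => [lab_m v vV vc|lab_m v /andP[]]; last exact: lab_m.
by apply: lab_m; rewrite vV.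
Qed.

Lemma vertex_label_le c v : v \in vertices -> le v c -> (lab v <= lbl c)%MM.
Proof. by move: v; apply/cell_label_leP/lepm_refl. Qed.

Lemma cell_label_mono c' c : le c' c -> (lbl c' <= lbl c)%MM.
Proof.
move=> c'c; apply/cell_label_leP => v vV vc'; apply: vertex_label_le => //.
by have [_ _ le_trans] := le_order; apply: le_trans c'c.
Qed.

Lemma cell_label_vertex v : v \in vertices -> lbl v = lab v.
Proof.
move=> vV; have := vV; rewrite inE => /andP[_ /eqP rv].
apply: lepm_anti; last by apply: vertex_label_le; case: le_order.
apply/cell_label_leP => w /[!inE] /andP[wD /eqP rw] wv.
suff -> : w = v by apply: lepm_refl.
apply/eqP; apply: contraT => nwv.
by have := crank_lt le_order wD wv nwv; rewrite rv rw.
Qed.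

Lemma cellular_moduleP r (f : chains) : M r f <->
  (forall c a, (f c)@_a != 0 -> [/\ c \in D, rk c = r & (lbl c <= a)%MM]).
Proof.
split=> [Mf c a fca|Mf c].
  have [/mulX_mcoeffP/(_ a fca) ca /(_ _)[]] := Mf c; last by split.
  by apply: contraNneq fca => ->; rewrite mcoeff0.
split; first by apply/mulX_mcoeffP => a /Mf[].
rewrite -msupp_eq0; case E: (msupp (f c)) => [//|a s] _.
by have [|] := Mf c a; first by rewrite -mcoeff_msupp E mem_head.
Qed.

Definition coefs a (f : chains) : {ffun T -> k} := [ffun c => (f c)@_a].

Definition monomial_chain a (u : {ffun T -> k}) : chains :=
  [ffun c => u c *: 'X_[a]].

Lemma coefs_boundary a f : coefs a (bd f) = bd (coefs a f).
Proof.
apply/ffunP => c; rewrite !ffunE raddf_sum; apply: eq_bigr => x _ /=.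
by rewrite ffunE !mulrzl raddfMz.
Qed.

Lemma mcoeff_boundary a f c : (bd f c)@_a = bd (coefs a f) c.
Proof. by rewrite -coefs_boundary [RHS]ffunE. Qed.

Lemma boundary_monomial_chain a u :
  bd (monomial_chain a u) = monomial_chain a (bd u).
Proof.
apply/ffunP => c; rewrite !ffunE scaler_suml; apply: eq_bigr => x _ /=.
by rewrite ffunE !mulrzl -scalerMzl.
Qed.

Lemma homogeneous_chainE a f : homogeneous a f -> f = monomial_chain a (coefs a f).
Proof.
move=> hf; apply/ffunP => c; rewrite !ffunE; have [x ->] := hf c.
by rewrite mcoeffZ mcoeffX eqxx mulr1.
Qed.

Lemma homogeneous_boundary a f : homogeneous a f -> homogeneous a (bd f).
Proof.
move=> /homogeneous_chainE ->; rewrite boundary_monomial_chain => c.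
by rewrite ffunE; exists (bd (coefs a f) c).
Qed.

Lemma sum_monomial_chain f d : (forall c, msize (f c) <= d)%N ->
  f = \sum_(a : 'X_{1..N < d}) monomial_chain a (coefs a f).
Proof.
move=> fd; apply/ffunP => c; rewrite sum_ffunE [LHS](mpolywE (fd c)).
by apply: eq_bigr => a _; rewrite !ffunE.
Qed.

Lemma cellular_module_boundary r f : M r.+1 f -> M r (bd f).
Proof.
move=> /cellular_moduleP Mf; apply/cellular_moduleP => c' a.
rewrite mcoeff_boundary => /(boundary_neq0_facet hinc)[c].
rewrite ffunE => /Mf[_ rc lca] /and4P[c'D _ c'c]; rewrite rc eqSS => /eqP <-.
by split=> //; apply: lepm_trans (cell_label_mono c'c) lca.
Qed.

Lemma cellular_moduleD r f h : M r f -> M r h -> M r (f + h).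
Proof.
move=> /cellular_moduleP Mf /cellular_moduleP Mh; apply/cellular_moduleP => c a.
rewrite ffunE mcoeffD; have [->|/Mf //] := eqVneq (f c)@_a 0.
by rewrite add0r => /Mh.
Qed.

Lemma cellular_module0 r : M r 0.
Proof. by apply/cellular_moduleP => c a; rewrite ffunE mcoeff0 eqxx. Qed.

Lemma monomial_chain_bounds r f a :
    (forall m, (exists2 c, c \in sublevel le D lab m & (0 < rk c)%N) ->
      acyclic le D inc k (sublevel le D lab m)) ->
    M r.+1 f -> bd f = 0 ->
  exists2 h, M r.+2 h & bd h = monomial_chain a (coefs a f).
Proof.
move=> acyc /cellular_moduleP Mf f0.
have chain_f : cellular_chain le D (sublevel le D lab a) r.+1 (coefs a f).
  by move=> c; rewrite ffunE => /Mf[cD rc lc]; rewrite inE cD.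
have [/existsP[c fc]|/existsPn fa0] := boolP [exists c, coefs a f c != 0];
  last first.
  exists 0; first exact: cellular_module0.
  rewrite raddf0; apply/ffunP => c; have := fa0 c.
  by rewrite !ffunE negbK => /eqP ->; rewrite scale0r.
have [||u chain_u bu] := acyc a _ r.+1 _ chain_f.
- by exists c; have [cA rc] := chain_f c fc; rewrite ?rc.
- by rewrite -coefs_boundary f0; apply/ffunP => x; rewrite !ffunE mcoeff0.
exists (monomial_chain a u); last by rewrite boundary_monomial_chain bu.
apply/cellular_moduleP => x b; rewrite ffunE mcoeffZ mcoeffX mulf_eq0 negb_or.
case/andP => /chain_u[/setIdP[xD xa] rx].
by have [<-|_] := eqVneq a b; rewrite ?eqxx.
Qed.

Lemma cellular_module_exact r f :
    (forall m, (exists2 c, c \in sublevel le D lab m & (0 < rk c)%N) ->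
      acyclic le D inc k (sublevel le D lab m)) ->
  M r.+1 f -> bd f = 0 -> exists2 h, M r.+2 h & bd h = f.
Proof.
move=> acyc Mf f0.
rewrite [f](@sum_monomial_chain f (\max_c msize (f c))); last first.
  by move=> c; apply: (leq_bigmax c).
apply: (big_ind (fun u => exists2 h, M r.+2 h & bd h = u)).
- by exists 0; [apply: cellular_module0|rewrite raddf0].
- move=> _ _ [h Mh <-] [h' Mh' <-].
  by exists (h + h'); [apply: cellular_moduleD|rewrite raddfD].
by move=> a _; apply: monomial_chain_bounds.
Qed.

Lemma cellular_module_free r : graded_free (M r).
Proof.
pose S := [set c in D | rk c == r].
pose b (j : 'I_#|S|) : chains :=
  [ffun c => if c == enum_val j then 'X_[lbl c] else 0].
have sumE (s : {ffun 'I_#|S| -> {mpoly k[N]}}) j :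
    \sum_i s i * b i (enum_val j) = s j * 'X_[lbl (enum_val j)].
  rewrite (bigD1 j) //= ffunE eqxx big1 ?addr0 // => i nij.
  by rewrite ffunE (inj_eq enum_val_inj) eq_sym (negPf nij) mulr0.
have sum0 (s : {ffun 'I_#|S| -> {mpoly k[N]}}) c : c \notin S ->
    \sum_i s i * b i c = 0.
  move=> cS; rewrite big1 // => i _; rewrite ffunE.
  case: eqP => [Ec|]; rewrite ?mulr0 //.
  by rewrite Ec enum_valP in cS.
have enumP c : c \in S -> exists j : 'I_#|S|, c = enum_val j.
  by move=> cS; exists (enum_rank_in cS c); rewrite enum_rankK_in.
exists #|S|, b; split=> [j|f].
  exists (lbl (enum_val j)) => c; rewrite /homogeneous_poly ffunE.
  by case: eqP => [->|_]; [exists 1; rewrite scale1r|exists 0; rewrite scale0r].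
split=> [Mf|[s [-> _]]].
  have [s sE] := fin_all_exists (fun j : 'I_#|S| => (Mf (enum_val j)).1).
  exists [ffun j => s j]; split=> [|s' fE].
    apply/ffunP => c; rewrite ffunE; have [/enumP[j ->]|cS] := boolP (c \in S).
      by rewrite sumE ffunE.
    rewrite sum0 //; apply/eqP; apply: contraNT cS => /(Mf c).2[cD rc].
    by rewrite inE cD rc /=.
  apply/ffunP => j; apply: (mulIf (mpolyX_neq0 k (lbl (enum_val j)))).
  by rewrite ffunE -sE fE ffunE sumE.
apply/cellular_moduleP => c a; rewrite ffunE.
have [cS|cS] := boolP (c \in S); last by rewrite sum0 // mcoeff0 eqxx.
have [cD /eqP rc] := setIdP cS; have [j Ej] := enumP c cS.
by rewrite Ej sumE -Ej => /mcoeff_mulX_le.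
Qed.

Lemma boundary_maxideal_mul r f :
    (forall c c', facet le D c' c -> (0 < rk c')%N -> lbl c <> lbl c') ->
  M r.+2 f -> maxideal_mul (M r.+1) (bd f).
Proof.
move=> lbl_neq Mf; have /cellular_moduleP Mbf := cellular_module_boundary Mf.
have lbl_lt c a : (bd f c)@_a != 0 -> exists j, (lbl c j < a j)%N.
  move=> bfca; have [_ rc _] := Mbf c a bfca.
  apply/existsP; apply: contraT => /existsPn none.
  have ac : (a <= lbl c)%MM by apply/mnm_lepP => j; rewrite leqNgt none.
  move: bfca; rewrite mcoeff_boundary => /(boundary_neq0_facet hinc)[c0].
  rewrite ffunE => /((cellular_moduleP _ _).1 Mf)[_ _ c0a] c0c.
  have [_ _ cc0 _] := and4P c0c; case: (lbl_neq _ _ c0c); first by rewrite rc.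
  by apply: lepm_anti; [apply: lepm_trans c0a ac|apply: cell_label_mono].
have var_le c j a : (lbl c j < a j)%N -> (U_(j) <= a)%MM.
  by move=> ja; rewrite lep1mP -lt0n; apply: leq_ltn_trans ja.
have [q qE] := fin_all_exists (fun c => mpoly_sum_mulX (var_le c) (@lbl_lt c)).
exists (fun j => [ffun c => q c j]); split=> [j|]; last first.
  apply/ffunP => c; rewrite [RHS]ffunE [LHS](qE c).1.
  by apply: eq_bigr => j _; rewrite ffunE mulrC.
apply/cellular_moduleP => c a; rewrite ffunE => /(qE c).2[].
rewrite mnmDE mnm1E eqxx ltnS => lbl_j /Mbf[cD rc /mnm_lepP lbl_a]; split=> //.
apply/mnm_lepP => i; have [<- //|/negPf nji] := eqVneq j i.
by have := lbl_a i; rewrite mnmDE mnm1E nji.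
Qed.

Variable o : T.
Hypotheses (oD : o \in D) (o_le : forall c, c \in D -> le o c).

Lemma augmentationE f : M 1 f -> bd f o = \sum_(v in vertices) f v.
Proof.
move=> Mf; have ro : rk o = 0%N by apply/eqP; rewrite (crank_eq0 le_order oD).
rewrite ffunE [RHS]big_mkcond [LHS]big_mkcond; apply: eq_bigr => c _ /=.
rewrite inE; have [cD|//] := boolP (c \in D); case: eqP => [rc|nrc].
  by rewrite (inc_vertex hinc) ?mul1r // /facet oD cD o_le // rc ro.
by have [->|/(Mf c).2[_ /nrc]] := eqVneq (f c) 0; first by rewrite mulr0.
Qed.

Lemma augmentation_image I p : generated_by I vertices lab ->
  (I p <-> exists2 f, M 1 f & bd f o = p).
Proof.
move=> gen; split=> [/gen[q ->]|[f Mf <-]].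
  pose f : chains := [ffun v => if v \in vertices then q v * 'X_[lab v] else 0].
  have Mf : M 1 f.
    apply/cellular_moduleP => c a; rewrite ffunE.
    case: ifP => [cV|_]; last by rewrite mcoeff0 eqxx.
    move=> /mcoeff_mulX_le; rewrite cell_label_vertex //.
    by move: cV; rewrite inE => /andP[-> /eqP ->].
  exists f; rewrite // augmentationE //; apply: eq_bigr => v vV.
  by rewrite ffunE vV.
apply/gen; have [q qE] := fin_all_exists (fun c => (Mf c).1).
exists q; rewrite augmentationE //; apply: eq_bigr => v vV.
by rewrite -(cell_label_vertex vV).
Qed.

Lemma ideal_complex_resolution I : ideal_complex le D inc lab I ->
  minimal_graded_free_resolution (fun i => M i.+1) (bd (A := {mpoly k[N]}))
    (fun f => bd f o) I.
Proof.
move=> [gen acyc lbl_neq]; split.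
- by move=> i; apply: cellular_module_free.
- by move=> i f; apply: cellular_module_boundary.
- by move=> i a f _; apply: homogeneous_boundary.
- by move=> a f _ /homogeneous_boundary; apply.
- move=> i f Mf; split=> [|[h _ <-]]; first exact: cellular_module_exact.
  by rewrite (boundary_boundary hinc).
- move=> f Mf; split=> [f0|[h _ <-]]; last first.
    by rewrite (boundary_boundary hinc) ffunE.
  apply: cellular_module_exact => //; apply/ffunP => c; rewrite [RHS]ffunE.
  apply/eqP; apply: contraT => bfc.
  have [cD /eqP] := (cellular_module_boundary Mf c).2 bfc.
  by rewrite (crank_eq0 le_order oD) // => /eqP co; rewrite co f0 eqxx in bfc.
- by move=> p; apply: augmentation_image.
move=> i f; apply: boundary_maxideal_mul => c c' /and4P[c'D cD c'c /eqP rc] rc'.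
apply: lbl_neq => //; apply/eqP => Ec; move: rc; rewrite Ec; exact: n_Sn.
Qed.

End CellularResolution.

(** * Sign vectors *)

Section SignVectors.

Variable E : finType.
Implicit Types (X Y Z F : signvec E) (P : pred (signvec E)) (i : E).

Definition supp X : {set E} := [set i | X i != szero].

Lemma in_supp X i : (i \in supp X) = (X i != szero).
Proof. by rewrite inE. Qed.

Lemma notin_supp X i : i \notin supp X -> X i = szero.
Proof. by rewrite in_supp negbK => /eqP. Qed.

Lemma svleP X Y : reflect {in supp X, X =1 Y} (svle X Y).
Proof.
apply: (iffP forallP) => XY i.
  by rewrite in_supp => /negPf Xi; have := XY i; rewrite Xi => /eqP.
by have := XY i; rewrite in_supp; case: eqP => //= _ /(_ isT) ->.
Qed.

Arguments svleP {X Y}.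

Lemma svle_supp X Y : svle X Y -> supp X \subset supp Y.
Proof.
by move=> /svleP XY; apply/subsetP => i Xi; rewrite in_supp -XY // -in_supp.
Qed.

Lemma svle_refl : reflexive (@svle E).
Proof. by move=> X; apply/svleP. Qed.

Lemma svle_trans : transitive (@svle E).
Proof.
move=> Y X Z XY /svleP YZ; apply/svleP => i Xi; rewrite (svleP XY) // YZ //.
exact: (subsetP (svle_supp XY)).
Qed.

Lemma svle_subface X Y Z :
  svle X Z -> svle Y Z -> supp X \subset supp Y -> svle X Y.
Proof.
move=> /svleP XZ /svleP YZ /subsetP sXY; apply/svleP => i Xi.
by rewrite XZ // YZ ?sXY.
Qed.

Lemma svle_supp_eq X Y : svle X Y -> supp Y \subset supp X -> X = Y.
Proof.
move=> /svleP XY /subsetP sYX; apply/ffunP => i.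
have [/XY //|Xi] := boolP (i \in supp X).
by rewrite !notin_supp //; apply: contra (sYX i) Xi.
Qed.

Lemma svle_anti : antisymmetric (@svle E).
Proof. by move=> X Y /andP[XY /svle_supp]; apply: svle_supp_eq. Qed.

Lemma svle_order : partial_order (@svle E).
Proof. by split; [apply: svle_refl|apply: svle_anti|apply: svle_trans]. Qed.

Lemma svle_proper X Y : svle X Y -> X != Y -> supp X \proper supp Y.
Proof.
move=> XY nXY; rewrite properE svle_supp //=.
by apply: contra nXY => sYX; apply/eqP/svle_supp_eq.
Qed.

Lemma sv0E i : sv0 E i = szero.
Proof. by rewrite ffunE. Qed.

Lemma supp0 : supp (sv0 E) = set0.
Proof. by apply/setP => i; rewrite in_supp sv0E inE. Qed.

Lemma supp_eq0 X : (supp X == set0) = (X == sv0 E).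
Proof.
apply/eqP/eqP => [X0|->]; last exact: supp0.
by apply/ffunP => i; rewrite sv0E notin_supp // X0 inE.
Qed.

Lemma svle0 X : svle (sv0 E) X.
Proof. by apply/svleP => i; rewrite supp0 inE. Qed.

Lemma svle_eq0 X : svle X (sv0 E) = (X == sv0 E).
Proof.
apply/idP/eqP => [|->]; last exact: svle_refl.
by move/svle_supp; rewrite supp0 subset0 supp_eq0 => /eqP.
Qed.

Lemma supp_svopp X : supp (svopp X) = supp X.
Proof. by apply/setP => i; rewrite !in_supp ffunE; case: (X i). Qed.

Lemma svcompE X Y i : svcomp X Y i = if i \in supp X then X i else Y i.
Proof. by rewrite ffunE in_supp; case: eqP. Qed.

Lemma supp_svcomp X Y : supp (svcomp X Y) = supp X :|: supp Y.
Proof.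
by apply/setP => i; rewrite in_setU [LHS]in_supp svcompE !in_supp; case: (X i).
Qed.

Lemma svle_svcomp X Y : svle X (svcomp X Y).
Proof. by apply/svleP => i Xi; rewrite svcompE Xi. Qed.

Lemma svcomp_svle X Y Z : svle X Z -> svle Y Z -> svle (svcomp X Y) Z.
Proof.
move=> /svleP XZ /svleP YZ; apply/svleP => i; rewrite supp_svcomp svcompE in_setU.
by have [/XZ //|_ /= /YZ] := boolP (i \in supp X).
Qed.

Lemma in_sep X Y i : (i \in sep X Y) = (i \in supp X) && (X i == svopp Y i).
Proof. by rewrite inE in_supp ffunE. Qed.

Lemma sepC X Y : sep X Y = sep Y X.
Proof.
by apply/setP => i; rewrite !inE; case: (X i) => [[]|]; case: (Y i) => [[]|].
Qed.

Lemma sep_subl X Y : sep X Y \subset supp X.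
Proof. by apply/subsetP => i; rewrite in_sep => /andP[]. Qed.

Lemma sep_subr X Y : sep X Y \subset supp Y.
Proof. by rewrite sepC sep_subl. Qed.

Lemma sep_id X : sep X X = set0.
Proof. by apply/setP => i; rewrite !inE; case: (X i) => [[]|]. Qed.

Lemma notin_sep X Y i :
  i \in supp X -> i \in supp Y -> i \notin sep X Y -> X i = Y i.
Proof. by rewrite !inE; case: (X i) => [[]|]; case: (Y i) => [[]|]. Qed.

Lemma sep_svopp X Y : sep X (svopp Y) = (supp X :&: supp Y) :\: sep X Y.
Proof.
apply/setP => i; rewrite !inE !ffunE.
by case: (X i) => [[]|]; case: (Y i) => [[]|].
Qed.

Lemma sep_svcomp X Y Z : sep X (svcomp Y Z) = sep X Y :|: (sep X Z :\: supp Y).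
Proof.
apply/setP => i; rewrite !inE !ffunE.
by case: (X i) => [[]|]; case: (Y i) => [[]|]; case: (Z i) => [[]|].
Qed.

Lemma sep_face X Y Z : svle Y Z -> sep X Y = sep X Z :&: supp Y.
Proof.
move=> /svleP YZ; apply/setP => i; rewrite in_setI.
have [iY|iY] := boolP (i \in supp Y); first by rewrite !inE YZ ?andbT.
by rewrite andbF; apply: contraNF iY; apply: (subsetP (sep_subr X Y)).
Qed.

Lemma svle_sep0 X Y : supp X \subset supp Y -> sep Y X = set0 -> svle X Y.
Proof.
move=> /subsetP sXY S0; apply/svleP => i Xi; apply/esym/notin_sep; rewrite ?sXY //.
by rewrite S0 inE.
Qed.

Definition bigcomp (P : pred (signvec E)) : signvec E :=
  \big[@svcomp E/sv0 E]_(X | P X) X.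

Lemma supp_bigcomp P : supp (bigcomp P) = \bigcup_(X | P X) supp X.
Proof. exact: (big_morph supp supp_svcomp supp0). Qed.

Lemma bigcomp_closed P : P (sv0 E) -> {in P &, forall X Y, P (svcomp X Y)} ->
  P (bigcomp P).
Proof. by move=> P0 Pcomp; apply: (big_ind P) => // X Y PX PY; apply: Pcomp. Qed.

Lemma bigcomp_svle P F : {in P, forall X, svle X F} -> svle (bigcomp P) F.
Proof.
move=> PF; apply: (big_ind (fun X => svle X F)) => [|X Y|//]; first exact: svle0.
exact: svcomp_svle.
Qed.

Lemma svle_bigcomp P F X : {in P, forall X, svle X F} -> P X -> svle X (bigcomp P).
Proof.
move=> PF PX; apply: svle_subface (PF X PX) (bigcomp_svle PF) _.
by rewrite supp_bigcomp; apply: bigcup_sup.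
Qed.

End SignVectors.

Arguments svleP {E X Y}.

Notation face_closed := (order_ideal (@svle _)).

(** * Covers and ranks of covectors *)

Lemma subset_of_setD (I : finType) (A B C S : {set I}) :
  S \subset A -> A :\: B \subset C :\: S -> S \subset B.
Proof.
move=> /subsetP sSA /subsetP sABC; apply/subsetP => i iS; apply: contraT => iB.
by have := sABC i; rewrite !in_setD iB iS sSA // => /(_ isT).
Qed.

Section Covectors.

Variables (E : finType) (L : {set signvec E}).
Hypothesis hL : oriented_matroid L.
Implicit Types (X Y Z V W F G M : signvec E) (D : {set signvec E}).
Implicit Types (e i : E) (S : {set E}).

Lemma om_comp_opp X Y : X \in L -> Y \in L -> svcomp (svopp X) Y \in L.
Proof. by move=> XL YL; apply: (om_comp hL) => //; apply: (om_opp hL). Qed.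

(* Walking from V towards V' until the first hyperplane separating them is
   reached, without crossing any. *)
Lemma conformal_elimination V V' : V \in L -> V' \in L ->
    supp V' \subset supp V -> sep V V' != set0 ->
  exists W, [/\ W \in L, svle W V, W != V & supp V :\: supp W \subset sep V V'].
Proof.
move=> VL; have [m] := ubnP #|sep V V'|.
elim: m V' => // m IH V' /ltnSE leS V'L sV'V /set0Pn[e eS].
have [Z [ZL Ze ZV]] := om_elim hL VL V'L eS.
have Zoff i : i \notin sep V V' -> Z i = V i.
  move=> /ZV[-> _]; rewrite svcompE; case: ifP => // /negbT Vi.
  by rewrite !notin_supp //; apply: contra Vi; apply: (subsetP sV'V).
have eZ : e \notin supp Z by rewrite in_supp Ze.
have eV : e \in supp V by apply: (subsetP (sep_subl V V')).
have sZV : supp Z \subset supp V.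
  apply/subsetP => i; have [iS _|/Zoff Zi] := boolP (i \in sep V V').
    exact: (subsetP (sep_subl V V')).
  by rewrite !in_supp Zi.
have sVZ : supp V :\: supp Z \subset sep V V'.
  apply/subsetP => i /setDP[iV iZ]; apply: contraT => /Zoff Zi.
  by rewrite in_supp Zi -in_supp iV in iZ.
have sS : sep V Z \subset sep V V'.
  apply/subsetP => i iS; apply: contraT => /Zoff Zi; move: iS.
  by rewrite inE Zi; case: (V i) => [[]|].
have [S0|S0] := eqVneq (sep V Z) set0.
  exists Z; split=> //; first exact: svle_sep0.
  by apply: contraNneq eZ => ->.
have [|W [WL WV nWV sVW]] := IH Z _ ZL sZV S0.
  apply: leq_trans leS; apply/proper_card/properP; split=> //; exists e => //.
  by apply: contra eZ; apply: (subsetP (sep_subr V Z)).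
by exists W; split=> //; apply: subset_trans sS.
Qed.

Definition proper_faces F : {set signvec E} := [set X in L | svle X F & X != F].

Lemma proper_facesP F X :
  reflect [/\ X \in L, svle X F & X != F] (X \in proper_faces F).
Proof. by rewrite inE; apply: and3P. Qed.

Definition cover G F : bool :=
  [&& G \in L, F \in L, svle G F, G != F &
    [forall X in L, svle G X && svle X F ==> (X == G) || (X == F)]].

Lemma coverP G F : reflect [/\ G \in L, F \in L, svle G F, G != F &
    forall X, X \in L -> svle G X -> svle X F -> X = G \/ X = F] (cover G F).
Proof.
apply: (iffP and5P) => -[GL FL GF nGF H]; split=> //.
  move=> X XL GX XF; have := forall_inP H X XL.
  by rewrite GX XF => /orP[]/eqP ->; [left|right].
apply/forall_inP => X XL; apply/implyP => /andP[GX XF].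
by case: (H X XL GX XF) => ->; rewrite eqxx ?orbT.
Qed.

Arguments coverP {G F}.

Lemma cover_above X F : X \in L -> F \in L -> svle X F -> X != F ->
  exists2 G, cover G F & svle X G.
Proof.
move=> XL FL XF nXF; have Xp : X \in proper_faces F by apply/proper_facesP.
have [G [/proper_facesP[GL GF nGF] XG Gmax]] :=
  maximal_above (@svle_order E) Xp.
exists G => //; apply/coverP; split=> // Y YL GY YF.
have [->|nYF] := eqVneq Y F; [by right|left].
by apply: Gmax => //; apply/proper_facesP.
Qed.

Lemma cover_supp G F : cover G F -> supp G \proper supp F.
Proof. by case/coverP => _ _ GF nGF _; apply: svle_proper. Qed.

Lemma separating_facet V V' : V \in L -> V' \in L ->
    supp V' \subset supp V -> sep V V' != set0 ->
  exists2 W, cover W V & supp V :\: supp W \subset sep V V'.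
Proof.
move=> VL V'L sV'V S0.
have [W [WL WV nWV sVW]] := conformal_elimination VL V'L sV'V S0.
have [G cGV WG] := cover_above WL VL WV nWV; exists G => //.
by apply: subset_trans sVW; apply/setDS/svle_supp.
Qed.

(* The elements of F outside G are parallel in the flat spanned by F. *)
Lemma cover_parallel G F Z : cover G F -> Z \in L -> supp Z \subset supp F ->
  ~~ (supp Z \subset supp G) -> supp F :\: supp G \subset supp Z.
Proof.
move=> cGF ZL sZF /subsetPn[e eZ eG]; have eF := subsetP sZF e eZ.
wlog eS : Z ZL sZF eZ / e \in sep F Z.
  move=> gen; have [eS|eS] := boolP (e \in sep F Z); first exact: gen.
  rewrite -(supp_svopp Z); apply: gen; rewrite ?supp_svopp ?(om_opp hL) //.
  by rewrite sep_svopp in_setD eS inE eF eZ.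
have [GL FL GF _ Gmax] := coverP cGF.
have sepGZ : sep F (svcomp G Z) = sep F Z :\: supp G.
  by rewrite sep_svcomp (sep_face F GF) sep_id set0I set0U.
have [|||W cWF sFW] := @separating_facet F (svcomp G Z) FL.
- exact: om_comp.
- by rewrite supp_svcomp subUset sZF svle_supp.
- by apply/set0Pn; exists e; rewrite sepGZ inE eG.
rewrite sepGZ in sFW; have [WL _ WF nWF _] := coverP cWF.
have GW : svle G W.
  exact: svle_subface GF WF (subset_of_setD (svle_supp GF) sFW).
have [EW|/eqP] := Gmax W WL GW WF; last by rewrite (negPf nWF).
rewrite -EW; apply: subset_trans sFW _.
exact: subset_trans (subsetDl _ _) (sep_subr _ _).
Qed.

Lemma supp_elimination X Y e : X \in L -> Y \in L -> e \in supp X :&: supp Y ->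
  exists Z, [/\ Z \in L, e \notin supp Z, supp Z \subset supp X :|: supp Y &
    (supp X :|: supp Y) :\: (supp X :&: supp Y) \subset supp Z].
Proof.
move=> XL YL eXY; wlog eS : Y YL eXY / e \in sep X Y.
  move=> gen; have [eS|eS] := boolP (e \in sep X Y); first exact: gen.
  rewrite -(supp_svopp Y); apply: gen; rewrite ?supp_svopp ?(om_opp hL) //.
  by rewrite sep_svopp inE eS.
have [Z [ZL Ze ZXY]] := om_elim hL XL YL eS.
exists Z; split=> //; first by rewrite in_supp Ze.
  apply/subsetP => i iZ; have [iS|/ZXY[Zi _]] := boolP (i \in sep X Y).
    by rewrite inE (subsetP (sep_subl X Y)).
  by rewrite -supp_svcomp in_supp -Zi -in_supp.
apply/subsetP => i /setDP[iXY niXY].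
have [|Zi _] := ZXY i; last by rewrite in_supp Zi -in_supp supp_svcomp.
apply: contra niXY => iS.
by rewrite inE (subsetP (sep_subl X Y)) ?(subsetP (sep_subr X Y)).
Qed.

Lemma max_supp_within S : exists M, [/\ M \in L, supp M \subset S &
  {in L, forall X, supp X \subset S -> supp X \subset supp M}].
Proof.
pose P := [pred X | (X \in L) && (supp X \subset S)].
have /andP[ML MS] : P (bigcomp P).
  apply: bigcomp_closed => [|X Y /andP[XL XS] /andP[YL YS]] /=.
    by rewrite (om_zero hL) supp0 sub0set.
  by rewrite (om_comp hL) // supp_svcomp subUset XS.
exists (bigcomp P); split=> // X XL XS.
by rewrite supp_bigcomp; apply: bigcup_sup; rewrite /= XL.
Qed.

Definition covector_supports : {set {set E}} := [set supp X | X in L].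

Definition srank X : nat :=
  crank (fun A B : {set E} => A \subset B) covector_supports (supp X).

Lemma subset_order : partial_order (fun A B : {set E} => A \subset B).
Proof.
split=> [A|A B|B A C]; [exact: subxx| |exact: subset_trans].
by rewrite -eqEsubset => /eqP.
Qed.

Lemma srank_le X Y : X \in L -> supp X \subset supp Y -> srank X <= srank Y.
Proof. by move=> XL; apply: (crank_le subset_order); apply: imset_f. Qed.

Lemma srank_lt X Y : X \in L -> supp X \proper supp Y -> srank X < srank Y.
Proof.
move=> XL; rewrite properEneq => /andP[nXY sXY].
by apply: (crank_lt subset_order); first exact: imset_f.
Qed.

Lemma srank_pred F : 0 < srank F ->
  exists Y, [/\ Y \in L, supp Y \proper supp F & srank F = (srank Y).+1].
Proof.
case/(crank_pred subset_order) => _ [/imsetP[Y YL ->] sYF nYF rF].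
by exists Y; split; rewrite // properEneq nYF.
Qed.

Lemma srank_eq0 X : X \in L -> (srank X == 0) = (X == sv0 E).
Proof.
move=> XL; rewrite -supp_eq0; apply: (crank_eq0 subset_order); rewrite ?imset_f //.
  by rewrite -supp0 imset_f ?(om_zero hL).
by move=> A _; apply: sub0set.
Qed.

(* Semimodularity of the lattice of flats, read on the complementary supports. *)
Lemma supp_meet_cover G F Y : cover G F -> Y \in L -> supp Y \subset supp F ->
    ~~ (supp Y \subset supp G) ->
  exists M, [/\ cover M (svcomp M Y), supp (svcomp M Y) = supp Y &
                supp M \subset supp G].
Proof.
move=> cGF YL sYF nYG; have [p pY pG] := subsetPn nYG.
have [M [ML /subsetIP[sMY sMG] Mmax]] := max_supp_within (supp Y :&: supp G).
have suppMY : supp (svcomp M Y) = supp Y by rewrite supp_svcomp; apply/setUidPr.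
have mem_p X : X \in L -> supp X \subset supp Y -> ~~ (supp X \subset supp G) ->
    p \in supp X.
  move=> XL sXY nXG; have sXF := subset_trans sXY sYF.
  by apply: (subsetP (cover_parallel cGF XL sXF nXG)); rewrite inE pG (subsetP sYF).
exists M; split=> //; apply/coverP; split.
- by [].
- exact: om_comp.
- exact: svle_svcomp.
- by apply: contraNneq nYG => EM; rewrite -suppMY -EM.
move=> X XL MX XMY; have sXY : supp X \subset supp Y by rewrite -suppMY svle_supp.
have [sXG|nXG] := boolP (supp X \subset supp G); [left|right].
  by apply/esym/svle_supp_eq => //; apply: Mmax; rewrite // subsetI sXY.
apply: svle_supp_eq; rewrite ?suppMY //.
apply/subsetP => i iY; apply: contraT => iX.
have [|Z [ZL pZ]] := supp_elimination (e := p) XL YL; first by rewrite inE mem_p.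
rewrite (setUidPr sXY) (setIidPl sXY) => sZY sYXZ.
have sZG : supp Z \subset supp G by apply: contraNT pZ; apply: mem_p.
have iZ : i \in supp Z by apply: (subsetP sYXZ); rewrite in_setD iX.
have sZM : supp Z \subset supp M by apply: Mmax; rewrite // subsetI sZY.
by have := subsetP (subset_trans sZM (svle_supp MX)) i iZ; rewrite (negPf iX).
Qed.

Lemma srank_cover G F : cover G F -> srank F = (srank G).+1.
Proof.
have [m] := ubnP #|supp F|; elim: m G F => // m IH G F /ltnSE leF cGF.
have [GL _ _ _ _] := coverP cGF.
have ltGF : srank G < srank F by apply: srank_lt (cover_supp cGF).
apply/eqP; rewrite eqn_leq ltGF andbT.
have [Y [YL pYF ->]] := srank_pred (leq_ltn_trans (leq0n _) ltGF).
rewrite ltnS; have [sYG|nYG] := boolP (supp Y \subset supp G).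
  exact: srank_le.
have sYF := proper_sub pYF.
have [M [cMY suppMY sMG]] := supp_meet_cover cGF YL sYF nYG.
have -> : srank Y = (srank M).+1.
  rewrite -(IH _ _ _ cMY); first by rewrite /srank suppMY.
  by rewrite suppMY; apply: leq_trans (proper_card pYF) leF.
have [ML _ _ _ _] := coverP cMY.
apply: srank_lt; rewrite // properEneq sMG andbT; apply: contraTneq pYF => eMG.
have sGY : supp G \subset supp Y by rewrite -eMG -suppMY supp_svcomp subsetUl.
rewrite properE negb_and negbK -(setID (supp F) (supp G)) subUset.
by rewrite (cover_parallel cGF) // (subset_trans (subsetIr _ _)) ?orbT.
Qed.

Lemma crank_face_closed D c : face_closed L D -> c \in D ->
  crank (@svle E) D c = srank c.
Proof.
move=> [/subsetP sDL idD]; have [m] := ubnP #|supp c|.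
elim: m c => // m IH c /ltnSE lec cD.
have IHc x : x \in D -> svle x c -> x != c -> crank (@svle E) D x = srank x.
  move=> xD xc nxc; apply: IH => //.
  exact: leq_trans (proper_card (svle_proper xc nxc)) lec.
have cL := sDL c cD; apply/eqP; rewrite eqn_leq; apply/andP; split.
  have [->//|] := posnP (crank (@svle E) D c).
  case/(crank_pred (@svle_order E)) => x [xD xc nxc ->].
  by rewrite IHc // srank_lt ?sDL // svle_proper.
have [c0|c0] := eqVneq (sv0 E) c.
  by have -> : srank c = 0 by apply/eqP; rewrite srank_eq0 ?c0.
have [G cGc _] := cover_above (om_zero hL) cL (svle0 c) c0.
have [GL _ Gc nGc _] := coverP cGc; have GD := idD G c GL cD Gc.
rewrite (srank_cover cGc) -IHc //.
exact: (crank_lt (@svle_order E)).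
Qed.

Lemma cover_of_srank X F : X \in L -> F \in L -> svle X F ->
  srank F = (srank X).+1 -> cover X F.
Proof.
move=> XL FL XF rF; apply/coverP; split=> //.
  by apply/eqP => EX; move: rF; rewrite EX => /n_Sn.
move=> Y YL XY YF; have [->|nYX] := eqVneq Y X; first by left.
have [->|nYF] := eqVneq Y F; first by right.
have := srank_lt YL (svle_proper YF nYF); rewrite rF ltnS leqNgt.
by rewrite (srank_lt XL) // svle_proper // eq_sym.
Qed.

Lemma facet_cover D G F : face_closed L D ->
  facet (@svle E) D G F = (F \in D) && cover G F.
Proof.
move=> hD; have [/subsetP sDL idD] := hD; apply/and4P/andP => [[GD FD GF]|[FD cGF]].
  rewrite !crank_face_closed // => /eqP; split=> //.
  by apply: cover_of_srank; rewrite ?sDL.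
have [GL _ GF _ _] := coverP cGF; have GD := idD G F GL FD GF.
by rewrite !crank_face_closed // (srank_cover cGF).
Qed.

Lemma cocircuit_below X i : X \in L -> i \in supp X ->
  exists Y, [/\ Y \in cocircuits L, svle Y X & i \in supp Y].
Proof.
move=> XL iX; pose A := [set Y in L | i \in supp Y].
have XA : X \in A by rewrite inE XL.
have [Y [/setIdP[YL iY] YX Ymin]] :=
  minimal_below (@svle_order E) XA.
exists Y; split=> //; rewrite inE YL /=; apply/andP; split.
  by rewrite -supp_eq0; apply/set0Pn; exists i.
apply/forall_inP => Z ZL; apply/implyP => /andP[Z0 ZY]; apply: contraT => nZY.
have iZ : i \notin supp Z.
  by apply: contra nZY => iZ; apply/eqP/Ymin; rewrite // inE ZL.
have sepYZ : sep Y (svopp Z) = supp Z.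
  by rewrite sep_svopp (sep_face Y ZY) sep_id set0I setD0; apply/setIidPr/svle_supp.
have [|||W cWY sYW] := @separating_facet Y (svopp Z) YL.
- exact: om_opp.
- by rewrite supp_svopp svle_supp.
- by rewrite sepYZ supp_eq0.
have [WL _ WY nWY _] := coverP cWY; case/eqP: nWY.
apply: Ymin; rewrite // inE WL /=.
by apply: contraNT iZ => iW; rewrite -sepYZ (subsetP sYW) // in_setD iW.
Qed.

Lemma cocircuitsE X : X \in cocircuits L = cover (sv0 E) X.
Proof.
apply/setIdP/coverP => [[XL /andP[X0 /forall_inP Xmin]]|[_ XL _ X0 Xmin]].
  split; rewrite ?(om_zero hL) ?svle0 // 1?eq_sym // => Y YL _ YX.
  have [->|Y0] := eqVneq Y (sv0 E); [by left|right].
  by have /implyP := Xmin Y YL; rewrite Y0 YX => /(_ isT)/eqP.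
split=> //; rewrite eq_sym X0; apply/forall_inP => Y YL.
apply/implyP => /andP[Y0 YX].
by case: (Xmin Y YL (svle0 Y) YX) => EY; rewrite EY eqxx // in Y0 *.
Qed.

End Covectors.

Arguments coverP {E L G F}.

(** * Sweeping the faces of a covector *)

Section FacesOff.

Variables (E : finType) (L : {set signvec E}).
Hypothesis hL : oriented_matroid L.
Implicit Types (X U V W F G : signvec E) (s : {set E}) (D : {set signvec E}).

Definition faces_off F s : {set signvec E} :=
  [set X in L | svle X F & s \subset supp X].

Lemma faces_offP F s X :
  reflect [/\ X \in L, svle X F & s \subset supp X] (X \in faces_off F s).
Proof. by rewrite inE; apply: and3P. Qed.

Definition face_interval U F : {set signvec E} :=
  [set X in L | svle U X & svle X F].

Lemma face_intervalP U F X :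
  reflect [/\ X \in L, svle U X & svle X F] (X \in face_interval U F).
Proof. by rewrite inE; apply: and3P. Qed.

Lemma face_interval_convex U F : order_convex (@svle E) L (face_interval U F).
Proof.
move=> X Y Z /face_intervalP[_ UX _] /face_intervalP[_ _ YF] ZL XZ ZY.
apply/face_intervalP; split=> //; first exact: svle_trans UX XZ.
exact: svle_trans ZY YF.
Qed.

Lemma face_interval_faces_off U F :
  svle U F -> face_interval U F = faces_off F (supp U).
Proof.
move=> UF; apply/setP => X.
apply/face_intervalP/faces_offP => [[XL UX XF]|[XL XF sUX]]; split=> //.
  exact: svle_supp.
exact: svle_subface UF XF sUX.
Qed.

Definition wall_faces F s W : {set signvec E} :=
  [set X in faces_off F s | supp X \subset supp W].

Lemma wall_faces_ideal F s W :
  order_ideal (@svle E) (faces_off F s) (wall_faces F s W).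
Proof.
split; first by apply/subsetP => X /setIdP[].
move=> X Y Xs /setIdP[_ YW] XY; rewrite inE Xs.
exact: subset_trans (svle_supp XY) YW.
Qed.

Lemma faces_off_convex D F s : D \subset L ->
  order_convex (@svle E) D (faces_off F s).
Proof.
move=> sDL X Y Z /faces_offP[_ _ sX] /faces_offP[_ YF _] ZD XZ ZY.
apply/faces_offP; split; first exact: (subsetP sDL).
  exact: svle_trans YF.
exact: subset_trans (svle_supp XZ).
Qed.

Lemma faces_off_punctured_ideal F G s : cover L G F ->
  order_ideal (@svle E) (faces_off F s) (faces_off F s :\: [set G; F]).
Proof.
move=> /coverP[_ _ _ _ Gmax]; split; first exact: subsetDl.
move=> X Y XQ /setDP[/faces_offP[YL YF _] nY] XY; rewrite in_setD XQ andbT.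
apply: contra nY => /set2P[] EX; rewrite EX in XY.
  by case: (Gmax Y YL XY YF) => ->; rewrite !inE eqxx ?orbT.
by rewrite (svle_anti (_ : svle Y F && svle F Y)) ?YF // !inE eqxx orbT.
Qed.

Lemma sep_reflect F V W : svle W V -> supp V = supp F -> sep F V \subset supp W ->
  sep F (svcomp W (svopp V)) = sep F V :|: (supp V :\: supp W).
Proof.
move=> WV suppV sW; rewrite sep_svcomp sep_svopp (sep_face F WV) suppV setIid.
by rewrite (setIidPl sW) setDDl (setUidPr sW).
Qed.

(* X0 witnesses that the wall W of V cuts out a face G of F. *)
Lemma faces_off_wall F V W X0 : W \in L -> svle W V -> supp V = supp F ->
    X0 \in faces_off F (sep F V) -> supp X0 \subset supp W ->
  exists G, [/\ G \in L, svle G F, supp G = supp W, sep G W = sep F V &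
    wall_faces F (sep F V) W = faces_off G (sep F V)].
Proof.
move=> WL WV suppV /faces_offP[X0L X0F sX0] X0W; pose G := svcomp X0 W.
have suppG : supp G = supp W by rewrite supp_svcomp; apply/setUidPr.
have GF : svle G F.
  apply/svleP => i; rewrite suppG svcompE => iW.
  have [iX0|iX0] := boolP (i \in supp X0); first exact: (svleP X0F).
  have iV : i \in supp V by apply: (subsetP (svle_supp WV)).
  rewrite (svleP WV) //; apply/esym/notin_sep; rewrite -?suppV //.
  by apply: contra iX0; apply: (subsetP sX0).
have sepG : sep G W = sep F V.
  rewrite (sep_face G WV) [sep G V]sepC (sep_face V GF) suppG -setIA setIid sepC.
  exact/setIidPl/(subset_trans sX0).
exists G; split=> //; first exact: (om_comp hL).
apply/setP => X; apply/setIdP/faces_offP => [[/faces_offP[XL XF sX] XW]|[XL XG sX]].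
  by split=> //; apply: svle_subface XF GF _; rewrite suppG.
split; last by rewrite -suppG svle_supp.
by apply/faces_offP; split=> //; apply: svle_trans GF.
Qed.

Lemma faces_off_cross F V W s : cover L W V -> supp V = supp F ->
  faces_off F (s :|: (supp V :\: supp W)) = faces_off F s :\: wall_faces F s W.
Proof.
move=> cWV suppV; have /properP[_ [e eV eW]] := cover_supp cWV.
apply/setP => X; rewrite in_setD [X \in wall_faces _ _ _]inE.
rewrite negb_and andb_orl andNb /=.
apply/faces_offP/andP => [[XL XF]|[nXW /faces_offP[XL XF sX]]].
  rewrite subUset => /andP[sX sVWX]; split; last exact/faces_offP.
  apply/subsetPn; exists e => //; apply: (subsetP sVWX).
  by rewrite in_setD eW.
split; rewrite // subUset sX; apply: (cover_parallel hL cWV) => //.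
by rewrite suppV svle_supp.
Qed.

End FacesOff.

Section Sweep.

Variables (E : finType) (L : {set signvec E}).
Hypothesis hL : oriented_matroid L.
Variables (D : {set signvec E}) (inc : signvec E -> signvec E -> int).
Hypothesis hD : face_closed L D.
Hypothesis hinc : incidence_function (@svle E) D inc.
Variable A : nzRingType.
Implicit Types (X U V W F G : signvec E) (s : {set E}).

Notation exact_cells := (exact_on D inc A).

Definition sweepable F : Prop := forall V, V \in L -> supp V = supp F ->
  sep F V != supp F -> exact_cells (faces_off L F (sep F V)).

Lemma exact_wall_faces F G V W : cover L G F -> cover L W V -> supp V = supp F ->
    sep F V \subset supp G -> supp V :\: supp W \subset supp G ->
    {in proper_faces L F, forall F', sweepable F'} ->
  exact_cells (wall_faces L F (sep F V) W).
Proof.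
move=> cGF cWV suppV sG sVWG sweep; have [WL _ WV _ _] := coverP cWV.
have [->|/set0Pn[X0 /setIdP[X0s X0W]]] := eqVneq (wall_faces L F (sep F V) W) set0.
  exact: exact_on_set0.
have [F' [F'L F'F suppF' sepF' ->]] := faces_off_wall hL WL WV suppV X0s X0W.
rewrite -sepF'; apply: sweep => //.
  apply/proper_facesP; split=> //; apply: contraTneq (cover_supp cWV) => EF'.
  by rewrite -suppF' EF' suppV properxx.
have /properP[_ [p pF pG]] := cover_supp cGF.
rewrite sepF' suppF'; apply: contraNneq pG => sepW; apply: contraT => pG.
have pW : p \in supp W.
  by apply: contraNT pG => pW; apply: (subsetP sVWG); rewrite in_setD pW suppV.
by rewrite (subsetP sG) ?sepW in pG.
Qed.

Lemma exact_faces_off_cross F G V W : cover L G F -> cover L W V ->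
    supp V = supp F -> sep F V \subset supp G ->
    supp V :\: supp W \subset supp G :\: sep F V ->
    {in proper_faces L F, forall F', sweepable F'} ->
  exact_cells (faces_off L F (sep F V :|: (supp V :\: supp W)) :\: [set G; F]) ->
  exact_cells (faces_off L F (sep F V) :\: [set G; F]).
Proof.
move=> cGF cWV suppV sG sVW sweep.
have /properP[_ [e eV eW]] := cover_supp cWV.
have sVWG : supp V :\: supp W \subset supp G := subset_trans sVW (subsetDl _ _).
have eG : e \in supp G by apply: (subsetP sVWG); rewrite in_setD eW.
set Q := faces_off L F (sep F V) :\: _; set I := wall_faces L F (sep F V) W.
have idI : order_ideal (@svle E) Q I.
  apply: order_idealS (wall_faces_ideal L F (sep F V) W); last exact: subsetDl.
  apply/subsetP => X /setIdP[XF XW]; rewrite in_setD XF andbT.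
  by apply: contra eW => /set2P[] EX; apply: (subsetP XW); rewrite EX // -suppV.
rewrite (faces_off_cross hL _ cWV suppV) setDDl [_ :|: [set G; F]]setUC -setDDl.
apply: (exact_on_glue hinc _ idI); last first.
  exact: (exact_wall_faces cGF).
apply: order_ideal_convex (faces_off_punctured_ideal _ cGF).
by apply: faces_off_convex; case: hD.
Qed.

(* Sweeping from V = F to V = -G o F, each crossing of a hyperplane removes
   from the punctured boundary of F the faces of one facet of F, except those
   on previously crossed hyperplanes: a set of the same kind. *)
Lemma exact_faces_off_punctured F G V : cover L G F ->
    {in proper_faces L F, forall F', sweepable F'} ->
    V \in L -> supp V = supp F -> sep F V \subset supp G ->
  exact_cells (faces_off L F (sep F V) :\: [set G; F]).
Proof.
move=> cGF sweep; have [GL FL GF _ Gmax] := coverP cGF.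
have [m] := ubnP #|supp G :\: sep F V|.
elim: m V => // m IH V /ltnSE leV VL suppV sG.
have [Gs|Gs] := eqVneq (supp G :\: sep F V) set0.
  suff -> : faces_off L F (sep F V) :\: [set G; F] = set0 by apply: exact_on_set0.
  apply/eqP; rewrite setD_eq0; apply/subsetP => X /faces_offP[XL XF sX].
  have GX : svle G X.
    by apply: (svle_subface GF XF); apply: subset_trans sX; rewrite -setD_eq0 Gs.
  by case: (Gmax X XL GX XF) => ->; rewrite !inE eqxx ?orbT.
have sepVG : sep V (svcomp (svopp G) F) = supp G :\: sep F V.
  rewrite sep_svcomp sep_svopp supp_svopp (sep_face V GF) [sep V F]sepC suppV.
  rewrite (setIidPl sG) (setIidPr (svle_supp GF)).
  by move: sG; rewrite -setD_eq0 => /eqP ->; rewrite setU0.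
have [||W cWV] := separating_facet hL VL (om_comp_opp hL GL FL).
- by rewrite supp_svcomp supp_svopp suppV subUset subxx svle_supp.
- by rewrite sepVG.
rewrite sepVG => sVW; have [WL _ WV _ _] := coverP cWV.
have sW : sep F V \subset supp W := subset_of_setD (sep_subr F V) sVW.
apply: (exact_faces_off_cross cGF cWV) => //; rewrite -sep_reflect //; apply: IH.
- have /properP[_ [e eV eW]] := cover_supp cWV.
  have eVW : e \in supp V :\: supp W by rewrite in_setD eW.
  apply: leq_trans leV; rewrite sep_reflect //; apply/proper_card/properP.
  split; first exact/setDS/subsetUl.
  by exists e; [apply: (subsetP sVW)|rewrite in_setD in_setU eVW orbT].
- by rewrite (om_comp hL) ?(om_opp hL).
- by rewrite supp_svcomp supp_svopp -suppV; apply/setUidPr/svle_supp.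
by rewrite sep_reflect // subUset sG (subset_trans sVW) ?subsetDl.
Qed.

Lemma exact_faces_off F : F \in D -> sweepable F.
Proof.
have [m] := ubnP #|supp F|; elim: m F => // m IH F /ltnSE leF FD V VL suppV nsep.
have [sDL idD] := hD; have FL := subsetP sDL F FD.
have sepFV : sep F (svopp V) = supp F :\: sep F V by rewrite sep_svopp suppV setIid.
have [||G cGF] := separating_facet hL FL (om_opp hL VL).
- by rewrite supp_svopp suppV.
- by rewrite sepFV setD_eq0; apply: contra nsep => sF; rewrite eqEsubset sep_subl.
rewrite sepFV => sFG; have [GL _ GF _ _] := coverP cGF.
have sG : sep F V \subset supp G := subset_of_setD (sep_subl F V) sFG.
apply: (exact_on_glue hinc _ (faces_off_punctured_ideal _ cGF)).
- exact: faces_off_convex.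
- apply: exact_faces_off_punctured => // F' /proper_facesP[F'L F'F nF'F].
  apply: IH; last exact: idD F'F.
  by apply: leq_trans leF; apply/proper_card/svle_proper.
rewrite setDDr setDv set0U.
have -> : faces_off L F (sep F V) :&: [set G; F] = [set G; F].
  apply/setIidPr; apply/subsetP => _ /set2P[] ->; apply/faces_offP; split=> //.
    exact: svle_refl.
  exact: sep_subl.
by apply: (exact_on_facet_pair hinc); rewrite (facet_cover hL) // FD.
Qed.

Lemma exact_proper_faces_but F G : proper_faces L F \subset D -> cover L G F ->
  exact_cells (proper_faces L F :\ G).
Proof.
move=> /subsetP properD cGF; have [_ FL _ _ _] := coverP cGF.
have -> : proper_faces L F :\ G = faces_off L F (sep F F) :\: [set G; F].
  apply/setP => X; rewrite !inE sep_id sub0set andbT negb_or.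
  by case: (X == G); case: (X == F); rewrite ?andbF ?andbT.
apply: exact_faces_off_punctured => //; last by rewrite sep_id sub0set.
by move=> X XF; apply/exact_faces_off/properD.
Qed.

Lemma exact_interval U F : F \in D -> U \in L -> svle U F -> U != F ->
  exact_cells (face_interval L U F).
Proof.
move=> FD UL UF nUF; have FL := subsetP hD.1 _ FD.
have sepU : sep F (svcomp (svopp U) F) = supp U.
  rewrite sep_svcomp sep_id set0D setU0 sep_svopp (sep_face F UF) sep_id.
  by rewrite set0I setD0; apply/setIidPr/svle_supp.
rewrite face_interval_faces_off // -sepU.
apply: exact_faces_off; rewrite ?(om_comp_opp hL) //.
  by rewrite supp_svcomp supp_svopp; apply/setUidPr/svle_supp.
rewrite sepU; apply: contraNneq nUF => sU; apply/eqP/svle_supp_eq => //.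
by rewrite sU.
Qed.

End Sweep.

(** * Incidence functions *)

Section FacetCycles.

Local Open Scope ring_scope.

Variables (E : finType) (L : {set signvec E}).
Hypothesis hL : oriented_matroid L.
Variables (D : {set signvec E}) (inc : signvec E -> signvec E -> int).
Hypothesis hD : face_closed L D.
Hypothesis hinc : incidence_function (@svle E) D inc.
Variable T : signvec E.
Hypothesis properD : proper_faces L T \subset D.
Implicit Types (X Y G : signvec E) (y z : {ffun signvec E -> int}).

Notation bd := (boundary D inc (A := int)).

Definition facet_cycle z : Prop :=
  (forall X, z X != 0 -> cover L X T) /\ bd z = 0.

Lemma proper_faces_butP G X :
  reflect [/\ X \in L, svle X T, X != T & X != G] (X \in proper_faces L T :\ G).
Proof. by rewrite in_setD1 inE andbC -!andbA; apply: and4P. Qed.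

Lemma proper_faces_but_ideal G : cover L G T ->
  order_ideal (@svle E) D (proper_faces L T :\ G).
Proof.
case/coverP=> _ _ _ _ Gmax; have [/subsetP sDL _] := hD; split.
  exact: subset_trans (subsetDl _ _) properD.
move=> X Y /sDL XL /proper_faces_butP[YL YT nYT nYG] XY.
apply/proper_faces_butP; split=> //.
- exact: svle_trans XY YT.
- by apply: contraNneq nYT => EX; apply/eqP/svle_anti; rewrite YT -EX.
apply: contraNneq nYG => EX; rewrite EX in XY.
by case: (Gmax Y YL XY YT) => EY; rewrite EY eqxx // in nYT *.
Qed.

Lemma facet_cycle_exists G : cover L G T -> exists2 z, facet_cycle z & z G = 1.
Proof.
move=> cGT; have [GL TL GT nGT _] := coverP cGT.
have GD : G \in D by apply: (subsetP properD); apply/proper_facesP.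
set K := proper_faces L T :\ G; have idK := proper_faces_but_ideal cGT.
have [/subsetP sKD _] := idK.
pose dG : {ffun signvec E -> int} := [ffun X => (X == G)%:R].
have bdGE c : bd dG c = inc G c.
  rewrite ffunE (bigD1 G) //= ffunE eqxx mulr1 intz big1 ?addr0 // => x.
  by rewrite ffunE => /andP[_ /negPf ->]; rewrite mulr0.
have KbdG : chain_on K (bd dG).
  apply: chain_on_neq0 => c; rewrite bdGE => /(inc_neq0_facet hinc).
  rewrite (facet_cover hL) // => /andP[_ /coverP[cL _ cG ncG _]].
  apply/proper_faces_butP; split=> //; first exact: svle_trans GT.
  by apply: contraNneq ncG => EcT; apply/eqP/svle_anti; rewrite cG EcT.
have [c||h [Kh hr hE]] := exact_on_homogeneous (r := crank (@svle E) D G)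
    hinc (exact_proper_faces_but hL hD hinc properD cGT) KbdG.
- by rewrite bdGE => /(inc_neq0_facet hinc)/and4P[_ _ _ /eqP].
- by rewrite /boundary_on (boundary_boundary hinc) raddf0.
have bdhE : bd h = bd dG.
  by rewrite -hE /boundary_on restrict_id //; apply: (chain_on_boundary hinc).
have hG : h G = 0 by apply: Kh; rewrite in_setD1 eqxx.
exists (dG - h); last by rewrite !ffunE eqxx hG subr0.
split; last by rewrite raddfB /= bdhE subrr.
move=> X; rewrite !ffunE; have [-> //|_] := eqVneq X G.
rewrite sub0r oppr_eq0 => hX; have XK := chain_on_mem Kh hX.
have XD := sKD X XK; have [XL XT _ _] := proper_faces_butP _ _ XK.
apply: cover_of_srank => //.
have := chain_on_mem hr hX; rewrite inE !(crank_face_closed hL) // => /eqP ->.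
exact: srank_cover.
Qed.

Lemma facet_cycle_eq0 G z : cover L G T -> facet_cycle z -> z G = 0 -> z = 0.
Proof.
move=> cGT [zT z0] zG.
have Kz : chain_on (proper_faces L T :\ G) z.
  apply: chain_on_neq0 => X zX; have /coverP[XL _ XT nXT _] := zT X zX.
  by apply/proper_faces_butP; split=> //; apply: contraNneq zX => ->; rewrite zG.
have [|h Kh hE] := exact_proper_faces_but hL hD hinc properD cGT Kz.
  by rewrite /boundary_on z0 raddf0.
apply/ffunP => c; rewrite [RHS]ffunE; apply/eqP; apply: contraT => zc.
have cK := chain_on_mem Kz zc; have := zc; rewrite -hE ffunE cK.
case/(boundary_neq0_facet hinc) => x /(chain_on_mem Kh).
move=> /proper_faces_butP[xL xT nxT _].
rewrite (facet_cover hL) // => /andP[_ /coverP[_ _ cx ncx _]].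
have /coverP[_ _ _ _ /(_ x xL cx xT)] := zT c zc.
by case=> Ex; [rewrite Ex eqxx in ncx|rewrite Ex eqxx in nxT].
Qed.

Lemma facet_cycle_unit G G0 z : cover L G T -> cover L G0 T ->
  facet_cycle z -> z G0 = 1 -> z G = 1 \/ z G = -1.
Proof.
move=> cGT cG0T [zT z0] zG0; have [y [yT y0] yG] := facet_cycle_exists cGT.
have diffE X : (y - z *~ y G0) X = y X - z X * y G0.
  rewrite !ffunE -mulrzz; congr (_ - _).
  by case: (y G0) => m; rewrite /intmul ?ffunE ffunMnE.
have diff0 : y - z *~ y G0 = 0.
  apply: (facet_cycle_eq0 cG0T); last by rewrite diffE zG0 mul1r subrr.
  split; last by rewrite raddfB raddfMz /= y0 z0 mul0rz subrr.
  move=> X; rewrite diffE; have [->|/yT //] := eqVneq (y X) 0.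
  by have [->|/zT //] := eqVneq (z X) 0; rewrite mul0r subrr eqxx.
have /eqP := diffE G; rewrite diff0 ffunE yG eq_sym subr_eq0 => /eqP/esym.
by rewrite mulrC => /intUnitRing.unitzPl; rewrite qualifE => /pred2P.
Qed.

End FacetCycles.

Section IncidenceExtension.

Local Open Scope ring_scope.

Variables (E : finType) (L : {set signvec E}).
Hypothesis hL : oriented_matroid L.
Implicit Types (D : {set signvec E}) (X Y F G T : signvec E).
Implicit Types inc : signvec E -> signvec E -> int.

Lemma face_closedU1 D T : face_closed L D -> T \in L ->
    proper_faces L T \subset D ->
  face_closed L (T |: D).
Proof.
move=> [sDL idD] TL properD; split; first by rewrite subUset sub1set TL.
move=> X Y XL /setU1P[->|YD] XY; rewrite in_setU1; last by rewrite (idD X Y) ?orbT.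
have [//|nXT] := eqVneq X T; rewrite (subsetP properD) //.
exact/proper_facesP.
Qed.

Lemma incidence_function_cover D inc : face_closed L D ->
    (forall F G, F \in D -> cover L G F -> inc F G = 1 \/ inc F G = -1) ->
    (forall F G, inc F G != 0 -> F \in D /\ cover L G F) ->
    (forall F, F \in D -> cover L (sv0 E) F -> inc F (sv0 E) = 1) ->
    (forall F G, \sum_(X in D) inc F X * inc X G = 0) ->
  incidence_function (@svle E) D inc.
Proof.
move=> hD unit nz vertex sq; split=> //.
- by move=> F G; rewrite (facet_cover hL) // => /andP[]; apply: unit.
- move=> F G; apply: contraNeq => /nz[FD cGF].
  by rewrite (facet_cover hL) // FD.
move=> F G; rewrite (facet_cover hL) // => /andP[FD cGF] /eqP.
have [_ idD] := hD; have [GL _ GF _ _] := coverP cGF.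
rewrite (crank_face_closed hL) ?(idD G F) // (srank_eq0 hL) // => /eqP EG.
by rewrite EG in cGF *; apply: vertex.
Qed.

Definition incidence_update inc T z F : signvec E -> int :=
  if F == T then z else inc F.

Lemma incidence_update_sum0 D inc T (z : {ffun signvec E -> int}) F G :
    T \notin D -> boundary D inc z = 0 -> z T = 0 -> inc F T = 0 ->
    \sum_(X in D) inc F X * inc X G = 0 ->
  \sum_(X in T |: D) incidence_update inc T z F X * incidence_update inc T z X G = 0.
Proof.
move=> TD /ffunP/(_ G) z0 zT FT inc0; rewrite big_setU1 //=.
have -> : incidence_update inc T z F T = 0 by rewrite /incidence_update; case: ifP.
rewrite mul0r add0r (eq_bigr (fun X => incidence_update inc T z F X * inc X G)).
  rewrite /incidence_update; case: (F == T) => //.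
  move: z0; rewrite !ffunE => zG; rewrite -[RHS]zG.
  by apply: eq_bigr => X _; rewrite mulrC intz.
move=> X XD; rewrite [incidence_update _ _ _ X]/incidence_update.
by case: eqP => // XT; rewrite XT (negPf TD) in XD.
Qed.

Lemma incidence_extendU1 D inc T :
    face_closed L D -> incidence_function (@svle E) D inc ->
    sv0 E \in D -> T \in L -> T \notin D -> proper_faces L T \subset D ->
  exists2 inc', incidence_function (@svle E) (T |: D) inc' & {in D, inc' =1 inc}.
Proof.
move=> hD hinc D0 TL TD properD.
have T0 : sv0 E != T by apply: contraNneq TD => <-.
have [G0 cG0T _] := cover_above (om_zero hL) TL (svle0 T) T0.
have [z cyc_z zG0] := facet_cycle_exists hL hD hinc properD cG0T.
have [zT z0] := cyc_z.
have incP F G : inc F G != 0 -> (F \in D) && cover L G F.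
  by move=> /(inc_neq0_facet hinc); rewrite (facet_cover hL).
have updD F : F \in D -> incidence_update inc T z F = inc F.
  by rewrite /incidence_update; case: eqP => // ->; rewrite (negPf TD).
have updT : incidence_update inc T z T = z by rewrite /incidence_update eqxx.
exists (incidence_update inc T z); last exact: updD.
apply: incidence_function_cover; first exact: face_closedU1.
- move=> F G /setU1P[->|FD] cGF.
    by rewrite updT; apply: (facet_cycle_unit hL hD hinc properD cGF cG0T cyc_z).
  by rewrite updD //; apply: (inc_facet hinc); rewrite (facet_cover hL) // FD.
- move=> F G; rewrite /incidence_update in_setU1.
  by have [-> /zT //|_ /incP/andP[-> ->]] := eqVneq F T.
- move=> F /setU1P[->|FD] c0F; last first.
    rewrite updD //; apply: (inc_vertex hinc); rewrite ?(facet_cover hL) ?FD //.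
    by apply/eqP; rewrite (crank_face_closed hL) // (srank_eq0 hL) ?(om_zero hL).
  have [_ _ _ _ Gmax] := coverP c0F; have [G0L _ G0T nG0T _] := coverP cG0T.
  case: (Gmax G0 G0L (svle0 _) G0T) => EG0; last by rewrite EG0 eqxx in nG0T.
  by rewrite updT -EG0.
move=> F G; apply: incidence_update_sum0 => //; last exact: (inc_sum0 hinc).
  by apply/eqP; apply: contraT => /zT/coverP[_ _ _]; rewrite eqxx.
apply/eqP; apply: contraT => /incP/andP[FD /coverP[_ _ TF _ _]].
by rewrite (hD.2 T F TL FD TF) in TD.
Qed.

Lemma incidence_extend D D' inc :
    face_closed L D -> face_closed L D' -> D \subset D' -> sv0 E \in D ->
    incidence_function (@svle E) D inc ->
  exists2 inc', incidence_function (@svle E) D' inc' & {in D, inc' =1 inc}.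
Proof.
have [m] := ubnP #|D' :\: D|.
elim: m D inc => // m IH D inc /ltnSE leD hD hD' sDD' D0 hinc.
have [/eqP|/set0Pn[X XD'D]] := eqVneq (D' :\: D) set0.
  rewrite setD_eq0 => sD'D; have <- : D = D' by apply/eqP; rewrite eqEsubset sDD'.
  by exists inc.
have [T [/setDP[TD' TD] _ Tmin]] :=
  minimal_below (@svle_order E) XD'D.
have TL := subsetP hD'.1 T TD'.
have properD : proper_faces L T \subset D.
  apply/subsetP => Y /proper_facesP[YL YT]; apply: contraNT => YD.
  by apply/eqP/Tmin; rewrite // in_setD YD (hD'.2 Y T).
have [incT hincT incTE] := incidence_extendU1 hD hinc D0 TL TD properD.
have [|||||inc' hinc' inc'E] := IH (T |: D) incT _ _ _ _ _ hincT.
- apply: leq_trans leD; apply/proper_card/properP.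
  split; first exact/setDS/subsetUr.
  by exists T; rewrite !inE ?TD ?TD' ?eqxx.
- exact: face_closedU1.
- by [].
- by rewrite subUset sub1set TD'.
- by rewrite in_setU1 D0 orbT.
by exists inc' => // F FD; rewrite inc'E ?incTE // in_setU1 FD orbT.
Qed.

Lemma incidence_function_exists D : face_closed L D -> sv0 E \in D ->
  exists inc, incidence_function (@svle E) D inc.
Proof.
move=> hD D0; have h0 : face_closed L [set sv0 E].
  split; first by rewrite sub1set (om_zero hL).
  by move=> X _ _ /set1P ->; rewrite svle_eq0 inE.
have not_cover F G : F \in [set sv0 E] -> ~ cover L G F.
  by move=> /set1P -> /coverP[_ _]; rewrite svle_eq0 => /eqP ->; rewrite eqxx.
have [|||inc' hinc' _] := @incidence_extend [set sv0 E] D (fun _ _ => 0) h0 hD.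
- by rewrite sub1set.
- by rewrite inE.
- apply: incidence_function_cover => [//|F G F0|F G|F F0|F G].
  - by move/(not_cover _ _ F0).
  - by rewrite eqxx.
  - by move/(not_cover _ _ F0).
  by rewrite big1 // => X _; rewrite mul0r.
by exists inc'.
Qed.

End IncidenceExtension.

(** * The bounded complex *)

Section BoundedComplex.

Variables (E : finType) (L : {set signvec E}) (g : E).
Hypothesis hL : oriented_matroid L.
Implicit Types (X Y Z U T : signvec E) (P : {set E * bool}) (e : E).

Notation B := (bounded_covectors L g).
Notation Lpos := (positive_part L g).

Lemma positiveP X : reflect (X \in L /\ X g = splus) (X \in Lpos).
Proof. by rewrite inE; apply: (iffP andP) => -[XL /eqP]. Qed.

Lemma boundedP X : reflect
  (X \in L /\ {in L, forall Y, Y != sv0 E -> svle Y X -> Y \in Lpos}) (X \in B).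
Proof.
rewrite inE; apply: (iffP andP) => -[XL H]; split=> //.
  by move=> Y YL Y0 YX; have /implyP := forall_inP H Y YL; rewrite Y0; apply.
by apply/forall_inP => Y YL; apply/implyP => /andP[]; apply: H.
Qed.

Lemma bounded_face_closed : face_closed L B.
Proof.
split; first by apply/subsetP => X /boundedP[].
move=> X Y XL /boundedP[_ bX] XY; apply/boundedP; split=> // Z ZL Z0 ZX.
by apply: bX => //; apply: svle_trans XY.
Qed.

Lemma bounded_sv0 : sv0 E \in B.
Proof.
apply/boundedP; split; first exact: om_zero hL.
by move=> Y _ /negPf Y0; rewrite svle_eq0 Y0.
Qed.

Lemma bounded_positive X : X \in B -> X != sv0 E -> X \in Lpos.
Proof. by case/boundedP => XL H X0; apply: H => //; apply: svle_refl. Qed.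

Lemma bounded_vertices_sub : bounded_vertices L g \subset B.
Proof.
apply/subsetP => X /setIP[/setIdP[XL /andP[_ /forall_inP Xmin]] Xpos].
apply/boundedP; split=> // Y YL Y0 YX.
by have /implyP := Xmin Y YL; rewrite Y0 YX => /(_ isT)/eqP ->.
Qed.

Lemma bounded_vertex_below X : X \in Lpos ->
  exists2 Y, Y \in bounded_vertices L g & svle Y X.
Proof.
case/positiveP => XL Xg; have [|Y [Yc YX gY]] := cocircuit_below hL (i := g) XL.
  by rewrite in_supp Xg.
exists Y; rewrite // inE Yc; apply/positiveP; rewrite (svleP YX) //; split=> //.
by case/setIdP: Yc.
Qed.

Definition face_at_infinity X : signvec E :=
  bigcomp [pred Y | [&& Y \in L, svle Y X & Y g == szero]].

Lemma face_at_infinityP X : [/\ face_at_infinity X \in L,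
  svle (face_at_infinity X) X & face_at_infinity X g = szero].
Proof.
pose P := [pred Y | [&& Y \in L, svle Y X & Y g == szero]].
suff /and3P[ML MX /eqP Mg] : P (face_at_infinity X) by [].
apply: bigcomp_closed; first by rewrite /= (om_zero hL) svle0 sv0E.
move=> Y Z /and3P[YL YX /eqP Yg] /and3P[ZL ZX /eqP Zg].
by rewrite /= (om_comp hL) // svcomp_svle // svcompE in_supp Yg Zg.
Qed.

Lemma face_at_infinity_max X Y :
  Y \in L -> svle Y X -> Y g = szero -> svle Y (face_at_infinity X).
Proof.
move=> YL YX Yg; apply: (@svle_bigcomp _ _ X) => [Z /and3P[] //|].
by rewrite /= YL YX Yg.
Qed.

Lemma face_at_infinity_mono :
  {homo face_at_infinity : X Y / svle X Y >-> svle X Y}.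
Proof.
move=> X Y XY; have [ML MX Mg] := face_at_infinityP X.
by apply: face_at_infinity_max => //; apply: svle_trans XY.
Qed.

Definition fibre_at_infinity T U : {set signvec E} :=
  [set X in L | svle X T & face_at_infinity X == U].

Lemma fibre_at_infinityP T U X :
  reflect [/\ X \in L, svle X T & face_at_infinity X = U]
          (X \in fibre_at_infinity T U).
Proof. by rewrite inE; apply: (iffP and3P) => -[XL XT /eqP]. Qed.

Lemma fibre_at_infinity_ideal T U : U \in L -> U g = szero ->
  order_ideal (@svle E) (face_interval L U T) (fibre_at_infinity T U).
Proof.
move=> UL Ug; split=> [|X Y /face_intervalP[XL UX XT] /fibre_at_infinityP[_ _ YU] XY].
  apply/subsetP => X /fibre_at_infinityP[XL XT XU].
  apply/face_intervalP; split; rewrite // -XU.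
  by have [] := face_at_infinityP X.
apply/fibre_at_infinityP; split=> //; apply: svle_anti.
by rewrite -{1}YU face_at_infinity_mono // face_at_infinity_max.
Qed.

Lemma fibre_at_infinity0 T : T \in Lpos ->
  fibre_at_infinity T (sv0 E) = [set X in B | svle X T].
Proof.
case/positiveP => _ Tg; apply/setP => X.
apply/fibre_at_infinityP/setIdP => [[XL XT X0]|[XB XT]].
  split=> //; apply/boundedP; split=> // Y YL Y0 YX; apply/positiveP; split=> //.
  rewrite -Tg (svleP (svle_trans YX XT)) // in_supp; apply: contra Y0 => /eqP Yg.
  by rewrite -svle_eq0 -X0 face_at_infinity_max.
have [XL Xb] := boundedP _ XB; have [ML MX Mg] := face_at_infinityP X.
split=> //; apply/eqP; apply: contraT => M0.
by have /positiveP[_] := Xb _ ML M0 MX; rewrite Mg.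
Qed.

Definition signed_supp X : {set E * bool} := [set p | X p.1 == Some p.2].

Lemma svle_signed_supp X Y : svle X Y -> signed_supp X \subset signed_supp Y.
Proof.
move=> /svleP XY; apply/subsetP => -[i b]; rewrite !inE /= => /eqP Xi.
by rewrite -XY ?in_supp Xi.
Qed.

Lemma signed_supp_svcomp X Y :
  signed_supp (svcomp X Y) \subset signed_supp X :|: signed_supp Y.
Proof.
apply/subsetP => -[i b]; rewrite !inE svcompE /=.
by case: ifP => _ ->; rewrite ?orbT.
Qed.

Lemma signed_elimination X Y e : X \in L -> Y \in L -> e \in sep X Y ->
  exists Z, [/\ Z \in L, Z e = szero,
    signed_supp Z \subset signed_supp X :|: signed_supp Y &
    forall i, i \notin sep X Y -> Z i = svcomp X Y i].
Proof.
move=> XL YL eS; have [Z [ZL Ze ZXY]] := om_elim hL XL YL eS.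
exists Z; split=> //; last by move=> i /ZXY[].
apply/subsetP => -[i b] iZ; have [iS|/ZXY[Zi _]] := boolP (i \in sep X Y).
  move: iS iZ; rewrite !inE /=.
  by case: (X i) => [[]|]; case: (Y i) => [[]|] //; case: b.
by apply: (subsetP (signed_supp_svcomp X Y)); rewrite inE -Zi; rewrite inE in iZ.
Qed.

(* A set P of signed elements stands for an intersection of closed half-spaces:
   the sign b is allowed at e when (e, b) is in P. *)
Definition bounded_region P : {set signvec E} :=
  [set X in B | signed_supp X \subset P].

Lemma in_bounded_region P X :
  (X \in bounded_region P) = (X \in B) && (signed_supp X \subset P).
Proof. by rewrite [LHS]inE. Qed.

Lemma bounded_region_face_closed P : face_closed L (bounded_region P).
Proof.
have [sBL idB] := bounded_face_closed; split.
  by apply/subsetP => X /setIdP[/(subsetP sBL)].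
move=> X Y XL /setIdP[YB YP] XY; rewrite in_bounded_region (idB X Y) //.
exact: subset_trans (svle_signed_supp XY) YP.
Qed.

Lemma bounded_regionI P P' :
  bounded_region P :&: bounded_region P' = bounded_region (P :&: P').
Proof.
apply/setP => X; rewrite in_setI !in_bounded_region subsetI.
by case: (X \in B).
Qed.

Lemma bounded_regionU P e :
  bounded_region P =
  bounded_region (P :\ (e, true)) :|: bounded_region (P :\ (e, false)).
Proof.
apply/setP => X; rewrite in_setU !in_bounded_region !subsetD1 -!andb_orr !inE /=.
by case: (X e) => [[]|]; rewrite /= ?andbT ?orbT.
Qed.

Definition has_positive P : bool := [exists X in Lpos, signed_supp X \subset P].

Lemma bounded_region_sub P P' : ~~ has_positive P ->
  bounded_region P \subset bounded_region P'.
Proof.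
move=> /exists_inPn none; apply/subsetP => X.
rewrite !in_bounded_region => /andP[XB XP].
suff -> : X = sv0 E.
  rewrite bounded_sv0; apply/subsetP => -[i b].
  by rewrite inE /= sv0E.
by apply/eqP; apply: contraTT XP => X0; apply/none/bounded_positive.
Qed.

Lemma has_positive_split P e : has_positive P ->
  has_positive (P :\ (e, true)) || has_positive (P :\ (e, false)).
Proof.
case/exists_inP => X Xpos XP; apply/orP; case Xe: (X e == splus); [right|left];
  apply/exists_inP; exists X; rewrite // subsetD1 XP inE /= ?Xe //.
by rewrite (eqP Xe).
Qed.

Lemma has_positive_elimination P e :
    has_positive (P :\ (e, true)) -> has_positive (P :\ (e, false)) ->
  has_positive ((P :\ (e, true)) :&: (P :\ (e, false))).
Proof.
case/exists_inP => X Xpos; rewrite subsetD1 inE /= => /andP[XP nXe].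
case/exists_inP => Y Ypos; rewrite subsetD1 inE /= => /andP[YP nYe].
have [Xe|Xe] := boolP (X e == sminus); last first.
  by apply/exists_inP; exists X; rewrite // subsetI !subsetD1 !inE XP nXe Xe.
have [Ye|Ye] := boolP (Y e == splus); last first.
  by apply/exists_inP; exists Y; rewrite // subsetI !subsetD1 !inE YP nYe Ye.
have [XL Xg] := positiveP _ Xpos; have [YL Yg] := positiveP _ Ypos.
have eS : e \in sep X Y by rewrite inE (eqP Xe) (eqP Ye).
have [Z [ZL Ze ZXY Zoff]] := signed_elimination XL YL eS.
have ZP : signed_supp Z \subset P by apply: subset_trans ZXY _; rewrite subUset XP.
apply/exists_inP; exists Z; last by rewrite subsetI !subsetD1 !inE /= Ze ZP.
apply/positiveP; split=> //; rewrite Zoff; first by rewrite svcompE in_supp Xg.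
by rewrite inE Xg Yg.
Qed.

Definition consistent P : Prop :=
  forall e, ~~ [&& (e, true) \in P & (e, false) \in P].

Lemma consistent_svle P X Y : consistent P ->
    signed_supp X \subset P -> signed_supp Y \subset P -> supp X \subset supp Y ->
  svle X Y.
Proof.
move=> consP XP YP /subsetP sXY; apply/svleP => i iX.
have signP Z b : signed_supp Z \subset P -> Z i = Some b -> (i, b) \in P.
  by move=> /subsetP ZP Zi; apply: ZP; rewrite inE /= Zi.
have := sXY i iX; move: iX (consP i); rewrite !in_supp.
case Xi: (X i) => [b|] //; case Yi: (Y i) => [b'|] // _ + _.
have bP := signP X b XP Xi; have b'P := signP Y b' YP Yi.
by move: b b' bP b'P {Xi Yi} => [] [] bP b'P; rewrite ?bP ?b'P.
Qed.

Lemma max_signed_supp_within P : consistent P -> exists T,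
  [/\ T \in L, signed_supp T \subset P &
      {in L, forall X, signed_supp X \subset P -> svle X T}].
Proof.
move=> consP; pose Q := [pred X | (X \in L) && (signed_supp X \subset P)].
have /andP[TL TP] : Q (bigcomp Q).
  apply: bigcomp_closed => [|X Y /andP[XL XP] /andP[YL YP]] /=.
    by rewrite (om_zero hL); apply/subsetP => -[i b]; rewrite inE /= sv0E.
  rewrite (om_comp hL) //; apply: subset_trans (signed_supp_svcomp X Y) _.
  by rewrite subUset XP.
exists (bigcomp Q); split=> // X XL XP; apply: (consistent_svle consP XP TP).
by rewrite supp_bigcomp; apply: bigcup_sup; rewrite /= XL.
Qed.

Lemma bounded_region_consistent P : consistent P -> has_positive P ->
  exists2 T, T \in Lpos & bounded_region P = [set X in B | svle X T].
Proof.
move=> /max_signed_supp_within[T [TL TP Tmax]] /exists_inP[X0 X0pos X0P].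
exists T.
  have [X0L X0g] := positiveP _ X0pos; apply/positiveP; split=> //.
  by rewrite -(svleP (Tmax X0 X0L X0P)) // in_supp X0g.
apply/setP => X; rewrite in_bounded_region [RHS]inE.
apply/andP/andP => -[XB XT]; split=> //.
  by apply: Tmax => //; case/boundedP: XB.
exact: subset_trans (svle_signed_supp XT) TP.
Qed.

Section Acyclicity.

Variable inc : signvec E -> signvec E -> int.
Hypothesis hinc : incidence_function (@svle E) L inc.
Variable A : nzRingType.

Notation exact_cells := (exact_on L inc A).

Let LL : face_closed L L. Proof. by []. Qed.

Lemma exact_fibre_at_infinity T U : T \in L -> T g != szero ->
  U \in L -> svle U T -> U g = szero -> exact_cells (fibre_at_infinity T U).
Proof.
move=> TL Tg; have [m] := ubnP #|supp T :\: supp U|.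
elim: m U => // m IH U /ltnSE leU UL UT Ug.
have idU := fibre_at_infinity_ideal T UL Ug.
have cvU := @face_interval_convex _ L U T; apply: (exact_on_sub hinc cvU idU).
  apply: (exact_interval hL LL hinc) => //.
  by apply: contraNneq Tg => <-; rewrite Ug.
apply: (exact_on_fibres hinc (@svle_order E) (phi := face_at_infinity)).
- exact: order_convexD.
- by move=> X Y _ _; apply: face_at_infinity_mono.
move=> X /setDP[/face_intervalP[XL UX XT] nXU].
have [ML MX Mg] := face_at_infinityP X.
have UM : svle U (face_at_infinity X) by apply: face_at_infinity_max.
have nUM : U != face_at_infinity X.
  by apply: contraNneq nXU => EU; apply/fibre_at_infinityP.
suff -> : [set Y in face_interval L U T :\: fibre_at_infinity T U |
            face_at_infinity Y == face_at_infinity X] =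
          fibre_at_infinity T (face_at_infinity X).
  apply: IH => //; last exact: svle_trans XT.
  apply: leq_trans leU; apply: proper_card.
  have [_ [i iM iU]] := properP (svle_proper UM nUM).
  apply/properP; split; first exact/setDS/svle_supp.
  exists i; rewrite !in_setD ?iU ?iM //=.
  exact: (subsetP (svle_supp (svle_trans MX XT))).
apply/setP => Y; apply/setIdP/fibre_at_infinityP => [[]|[YL YT EY]].
  by move=> /setDP[/face_intervalP[YL _ YT] _] /eqP.
rewrite EY eqxx; split=> //; apply/setDP; split.
  apply/face_intervalP; split=> //; apply: svle_trans UM _.
  by rewrite -EY; have [] := face_at_infinityP Y.
by apply: contra nUM => /fibre_at_infinityP[_ _ <-]; rewrite EY.
Qed.

Lemma exact_bounded_faces T : T \in Lpos -> exact_cells [set X in B | svle X T].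
Proof.
move=> Tpos; rewrite -fibre_at_infinity0 //; have [TL Tg] := positiveP _ Tpos.
apply: exact_fibre_at_infinity; rewrite ?Tg ?svle0 ?sv0E //.
exact: om_zero hL.
Qed.

(* Mayer-Vietoris along the hyperplanes e for which both signs are allowed. *)
Lemma exact_bounded_region P : has_positive P -> exact_cells (bounded_region P).
Proof.
have [m] := ubnP #|P|; elim: m P => // m IH P /ltnSE leP Ppos.
have [/existsP[e /andP[Pt Pf]]|/existsPn consP] :=
  boolP [exists e, [&& (e, true) \in P & (e, false) \in P]]; last first.
  have [T Tpos ->] := bounded_region_consistent consP Ppos.
  exact: exact_bounded_faces.
have IHS P' b : (e, b) \in P -> P' \subset P :\ (e, b) -> has_positive P' ->
    exact_cells (bounded_region P').
  move=> Pb sP'; apply: IH; apply: leq_trans leP; apply/proper_card.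
  by apply: sub_proper_trans sP' _; apply: properD1.
have sT := subxx (P :\ (e, true)); have sF := subxx (P :\ (e, false)).
rewrite (bounded_regionU P e).
have [posT|negT] := boolP (has_positive (P :\ (e, true))); last first.
  rewrite (setUidPr (bounded_region_sub _ negT)); apply: IHS Pf sF _.
  by have := has_positive_split e Ppos; rewrite (negPf negT).
have [posF|negF] := boolP (has_positive (P :\ (e, false))); last first.
  by rewrite (setUidPl (bounded_region_sub _ negF)); apply: IHS Pt sT posT.
have idR := bounded_region_face_closed; apply: (exact_on_setU hinc (idR _) (idR _)).
- exact: IHS Pt sT posT.
- exact: IHS Pf sF posF.
rewrite bounded_regionI; apply: IHS Pt _ _; first exact: subsetIl.
exact: has_positive_elimination.
Qed.

End Acyclicity.

End BoundedComplex.

(** * Oriented matroid ideals *)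

Section Labels.

Variable n : nat.
Implicit Types (X Y Z : signvec (option 'I_n)) (m : 'X_{1..n + n}).

Lemma sum_nat_pred1 (I : finType) (P : pred I) a :
  (\sum_(i | P i) (i == a) = P a)%N.
Proof.
rewrite big_mkcond (bigD1 a) //= eqxx big1 ?addn0; first by case: (P a).
by move=> i /negPf ->; rewrite if_same.
Qed.

Lemma xvar_lshift (e : option 'I_n) j : xvar e (lshift n j) = (e == Some j).
Proof. by case: e => [i|]; rewrite ?mnm0E // mnm1E eq_lshift. Qed.

Lemma xvar_rshift (e : option 'I_n) j : xvar e (rshift n j) = 0.
Proof. by case: e => [i|]; rewrite ?mnm0E // mnm1E eq_lrshift. Qed.

Lemma yvar_lshift (e : option 'I_n) j : yvar e (lshift n j) = 0.
Proof. by case: e => [i|]; rewrite ?mnm0E // mnm1E eq_rlshift. Qed.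

Lemma yvar_rshift (e : option 'I_n) j : yvar e (rshift n j) = (e == Some j).
Proof. by case: e => [i|]; rewrite ?mnm0E // mnm1E eq_rshift. Qed.

Lemma mxy_lshift Z j : mxy Z (lshift n j) = (Z (Some j) == splus).
Proof.
rewrite mnmDE !mnm_sumE (eq_bigr _ (fun e _ => xvar_lshift e j)) sum_nat_pred1.
by rewrite big1 ?addn0 // => e _; apply: yvar_lshift.
Qed.

Lemma mxy_rshift Z j : mxy Z (rshift n j) = (Z (Some j) == sminus).
Proof.
rewrite mnmDE !mnm_sumE big1 => [|e _]; last exact: xvar_rshift.
by rewrite (eq_bigr _ (fun e _ => yvar_rshift e j)) sum_nat_pred1.
Qed.

Definition sign_var (p : option 'I_n * bool) : 'X_{1..n + n} :=
  if p.2 then xvar p.1 else yvar p.1.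

Definition dividing_signs m : {set option 'I_n * bool} :=
  [set p | (sign_var p <= m)%MM].

Lemma None_dividing_signs m b : (None, b) \in dividing_signs m.
Proof. by rewrite inE; apply/mnm_lepP => i; case: b; rewrite mnm0E. Qed.

Lemma mxy_dividing_signs Z j b :
  ((Some j, b) \in dividing_signs (mxy Z)) = (Z (Some j) == Some b).
Proof.
rewrite inE /sign_var.
by case: b; rewrite /= lep1mP ?mxy_lshift ?mxy_rshift eqb0 negbK.
Qed.

Lemma mxy_le_signs Z m : (mxy Z <= m)%MM = (signed_supp Z \subset dividing_signs m).
Proof.
apply/mnm_lepP/subsetP => [Zm [[j|] b]|Zm i].
- rewrite inE /= => /eqP Zj; rewrite inE; case: b Zj => Zj; rewrite lep1mP -lt0n.
    by have := Zm (lshift n j); rewrite mxy_lshift Zj.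
  by have := Zm (rshift n j); rewrite mxy_rshift Zj.
- by move=> _; apply: None_dividing_signs.
case: (split_ordP i) => j ->; rewrite ?mxy_lshift ?mxy_rshift; case: eqP => // Zj.
  by have := Zm (Some j, true); rewrite !inE Zj lep1mP -lt0n; apply.
by have := Zm (Some j, false); rewrite !inE Zj lep1mP -lt0n; apply.
Qed.

Lemma svle_mxy X Y : svle X Y -> (mxy X <= mxy Y)%MM.
Proof.
move=> XY; rewrite mxy_le_signs; apply: subset_trans (svle_signed_supp XY) _.
by rewrite -mxy_le_signs lepm_refl.
Qed.

Lemma mxy_svle X Y : (mxy X <= mxy Y)%MM -> X None = Y None -> svle X Y.
Proof.
rewrite mxy_le_signs => /subsetP XY XYg; apply/svleP => -[j|] //; rewrite in_supp.
case Xj: (X (Some j)) => [b|] // _; have := XY (Some j, b).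
by rewrite mxy_dividing_signs inE /= Xj => /(_ (eqxx _))/eqP.
Qed.

Lemma mxy_inj X Y : mxy X = mxy Y -> X None = Y None -> X = Y.
Proof.
by move=> EXY XYg; apply: svle_anti; rewrite !mxy_svle ?EXY ?XYg ?lepm_refl.
Qed.

End Labels.

Section OrientedMatroidResolution.

Variables (k : fieldType) (n : nat) (L : {set signvec (option 'I_n)}).
Hypothesis hL : oriented_matroid L.
Implicit Types (X Y Z c v : signvec (option 'I_n)) (m : 'X_{1..n + n}).

Notation B := (bounded_covectors L None).
Notation le := (@svle (option 'I_n)).
Notation O := (om_ideal k L).

Let hB : face_closed L B := bounded_face_closed L None.

Lemma om_ideal_bounded_vertices : generated_by O (bounded_vertices L None) (@mxy n).
Proof.
move=> p; split=> /monomial_idealP Op; apply/monomial_idealP => a /Op[Z].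
  move=> /(bounded_vertex_below hL)[Y YV YZ] Za.
  by exists Y => //; apply: lepm_trans (svle_mxy YZ) Za.
by case/setIP => _ Zpos Za; exists Z.
Qed.

Lemma bounded_vertex_min Y Z : Y \in bounded_vertices L None ->
  Z \in bounded_vertices L None -> (mxy Y <= mxy Z)%MM -> Y = Z.
Proof.
case/setIP => /setIdP[YL /andP[Y0 _]] /positiveP[_ Yg].
case/setIP => /setIdP[_ /andP[_ /forall_inP Zmin]] /positiveP[_ Zg] YZ.
have /implyP := Zmin Y YL; rewrite Y0 mxy_svle ?Yg ?Zg //.
by move=> /(_ isT)/eqP.
Qed.

Lemma om_ideal_minimally_generated :
  minimally_generated_by O (bounded_vertices L None) (@mxy n).
Proof.
split; first exact: om_ideal_bounded_vertices.
move=> A' /properP[/subsetP sA' [v vV vA']] gen.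
have /gen/monomial_idealP/(_ (mxy v)) : O 'X_[mxy v].
  apply/om_ideal_bounded_vertices; exists (fun Z => (Z == v)%:R)%R.
  rewrite (bigD1 v) //= eqxx mul1r big1 ?addr0 // => Z /andP[_ /negPf ->].
  by rewrite mul0r.
rewrite mcoeffX eqxx oner_eq0 => /(_ isT)[t tA' tv].
by rewrite -(bounded_vertex_min (sA' t tA') vV tv) tA' in vA'.
Qed.

Lemma crank_bounded_eq0 c : c \in B -> (crank le B c == 0) = (c == sv0 _).
Proof.
apply: (crank_eq0 (@svle_order _)).
  exact: bounded_sv0.
by move=> X _; apply: svle0.
Qed.

Lemma bounded_complex_vertices : complex_vertices le B = bounded_vertices L None.
Proof.
have /eqP rank0 : crank le B (sv0 _) == 0 by rewrite crank_bounded_eq0 ?bounded_sv0.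
have facet0 c : c \in B -> (crank le B c == 1) = (c \in cocircuits L).
  move=> cB; rewrite (cocircuitsE hL) -[RHS]/(true && _) -cB -(facet_cover hL) //.
  by rewrite /facet rank0 bounded_sv0 // cB svle0.
apply/setP => v; apply/setIdP/idP => [[vB rv]|vV].
  rewrite inE -facet0 // rv; apply: (bounded_positive vB).
  by rewrite -crank_bounded_eq0 // (eqP rv).
have vB := subsetP (bounded_vertices_sub L None) v vV.
by rewrite facet0 //; case/setIP: vV.
Qed.

Lemma bounded_cell_label c : c \in B -> cell_label le B (@mxy n) c = mxy c.
Proof.
move=> cB; have [cL cb] := boundedP _ _ _ cB; apply: lepm_anti.
  by apply/cell_label_leP => v _; apply: svle_mxy.
rewrite mxy_le_signs; apply/subsetP => -[[j|] b]; last first.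
  by move=> _; apply: None_dividing_signs.
rewrite inE /= => /eqP cj.
have [|v [vc v_le_c jv]] := cocircuit_below hL (i := Some j) cL.
  by rewrite in_supp cj.
have vV : v \in complex_vertices le B.
  rewrite bounded_complex_vertices inE vc.
  apply: cb => //; first by case/setIdP: vc.
  by rewrite -supp_eq0; apply/set0Pn; exists (Some j).
have := vertex_label_le (@mxy n) vV v_le_c; rewrite mxy_le_signs => /subsetP; apply.
by rewrite inE /= (svleP v_le_c) ?cj.
Qed.

Lemma bounded_sublevel m :
  sublevel le B (@mxy n) m = bounded_region L None (dividing_signs m).
Proof.
apply/setP => c; rewrite [LHS]inE in_bounded_region.
by apply: andb_id2l => cB; rewrite bounded_cell_label // mxy_le_signs.
Qed.

Lemma bounded_sublevel_acyclic inc m : incidence_function le B inc ->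
    (exists2 c, c \in sublevel le B (@mxy n) m & 0 < crank le B c) ->
  acyclic le B inc k (sublevel le B (@mxy n) m).
Proof.
rewrite bounded_sublevel => hinc [c]; rewrite in_bounded_region => /andP[cB cm].
rewrite lt0n crank_bounded_eq0 // => c0.
have LL : face_closed L L by [].
have [inc' hinc' inc'E] :=
  incidence_extend hL hB LL hB.1 (bounded_sv0 None hL) hinc.
have sRB : bounded_region L None (dividing_signs m) \subset B.
  by apply/subsetP => X /setIdP[].
apply: (exact_on_acyclic hinc).
  exact: order_idealS sRB hB.1 (bounded_region_face_closed _ _ _).
apply: (eq_exact_on hB.1 sRB inc'E); apply: (exact_bounded_region hL hinc').
by apply/exists_inP; exists c; rewrite // bounded_positive.
Qed.

Lemma bounded_ideal_complex inc : incidence_function le B inc ->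
  ideal_complex le B inc (@mxy n) O.
Proof.
move=> hinc; split.
- by rewrite bounded_complex_vertices; apply: om_ideal_bounded_vertices.
- by move=> m; apply: bounded_sublevel_acyclic.
move=> c c' cB c'B rc' c'c nc'c; rewrite !bounded_cell_label // => Ecc'.
have c'0 : c' != sv0 _ by rewrite -crank_bounded_eq0 -?lt0n.
have c0 : c != sv0 _ by apply: contraNneq c'0 => Ec; rewrite -svle_eq0 -Ec.
have [_ cg] := positiveP _ _ _ (bounded_positive cB c0).
have [_ c'g] := positiveP _ _ _ (bounded_positive c'B c'0).
by case/eqP: nc'c; apply: mxy_inj; rewrite // c'g.
Qed.

End OrientedMatroidResolution.

Theorem theorem2p2 (k : fieldType) (n : nat)
    (L : {set signvec (option 'I_n)})
    (hM : affine_oriented_matroid L None) :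
  let O : {mpoly k[n + n]} -> Prop := om_ideal k L in
  let B : {set signvec (option 'I_n)} := bounded_covectors L None in
  let le : rel (signvec (option 'I_n)) := @svle (option 'I_n) in
  minimally_generated_by O (bounded_vertices L None) (@mxy n) /\
  (exists inc, incidence_function le B inc) /\
  forall inc : signvec (option 'I_n) -> signvec (option 'I_n) -> int,
    incidence_function le B inc ->
    ideal_complex le B inc (@mxy n) O /\
    minimal_graded_free_resolution
      (fun i => cellular_module le B (@mxy n) i.+1)
      (boundary B inc (A := {mpoly k[n + n]}))
      (fun f => boundary B inc f (sv0 (option 'I_n)))
      O.
Proof.
move=> O B le; have [hL _] := hM.
have B0 : sv0 _ \in B := bounded_sv0 None hL.
split; first exact: om_ideal_minimally_generated.
split; first exact: (incidence_function_exists hL (bounded_face_closed L None) B0).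
move=> inc hinc; have icx := bounded_ideal_complex k hL hinc; split=> //.
apply: ideal_complex_resolution => //; first exact: svle_order.
by move=> c _; apply: svle0.
Qed.
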